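(* For every $\mu>0$ there exist a real $3\times3$ matrix-valued function $A=A_\mu(x,y,t)$ on $\mathbb{T}^2\times\mathbb{R}$, uniformly elliptic and uniformly $C^1$, and a non-zero real, uniformly $C^2$ function $u=u_\mu(x,y,t)$ on $\mathbb{T}^2\times\mathbb{R}$ such that $$\operatorname{div}(A\nabla u)=-\mu u\quad\text{in }\mathbb{T}^2\times\mathbb{R},$$ and $u$ has double exponential decay in both directions: there are constants $c=c(\mu)>0$, $C=C(\mu)>0$ such that for all sufficiently large $T$, $$\sup_{\mathbb{T}^2\times\{|t|\ge T\}}|u(x,y,t)|\le Ce^{-ce^{cT}}.$$
   Context: $\mathbb{T}^2=(\mathbb{R}/2\pi\mathbb{Z})^2$ with periodic coordinates $(x,y)$; $t\in\mathbb{R}$ is the third coordinate. $\nabla$ and $\operatorname{div}$ are taken in $(x,y,t)$. Uniformly elliptic: there is $\Lambda\ge1$ with $\Lambda^{-1}|\xi|^2\le\xi^TA\xi\le\Lambda|\xi|^2$ for all $\xi\in\mathbb{R}^3$ and all points. Uniformly $C^1$ (resp. $C^2$): all partial derivatives of order $\le1$ (resp. $\le2$) are continuous and bounded on the whole domain. *)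

(* Defs.v *)
From Stdlib Require Import Reals.
From Coquelicot Require Import Coquelicot.
Open Scope R_scope.

(* A function on T^2 x R, written in coordinates (x, y, t) : R^3. *)
Definition fun3 := R -> R -> R -> R.

(* 2*PI-periodicity in x and y: f descends to T^2 x R. *)
Definition periodic_xy (f : fun3) : Prop :=
  forall x y t, f (x + 2 * PI) y t = f x y t /\ f x (y + 2 * PI) t = f x y t.

Definition coord (i : nat) (x y t : R) : R :=
  match i with 0%nat => x | 1%nat => y | _ => t end.

Definition slice (i : nat) (f : fun3) (x y t : R) : R -> R :=
  match i with
  | 0%nat => fun s => f s y t
  | 1%nat => fun s => f x s t
  | _ => fun s => f x y s
  end.

Definition pd (i : nat) (f : fun3) : fun3 :=
  fun x y t => Derive (slice i f x y t) (coord i x y t).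

Definition has_pd (i : nat) (f : fun3) : Prop :=
  forall x y t, ex_derive (slice i f x y t) (coord i x y t).

Definition continuous3 (f : fun3) : Prop :=
  forall x y t eps, 0 < eps -> exists delta, 0 < delta /\
    forall x' y' t', Rabs (x' - x) < delta -> Rabs (y' - y) < delta ->
      Rabs (t' - t) < delta -> Rabs (f x' y' t' - f x y t) < eps.

Definition bounded3 (f : fun3) : Prop :=
  exists M, forall x y t, Rabs (f x y t) <= M.

Definition unif_C1 (f : fun3) : Prop :=
  continuous3 f /\ bounded3 f /\
  forall i, (i < 3)%nat -> has_pd i f /\ continuous3 (pd i f) /\ bounded3 (pd i f).

Definition unif_C2 (f : fun3) : Prop :=
  unif_C1 f /\ forall i, (i < 3)%nat -> unif_C1 (pd i f).

Definition sum3 (g : nat -> R) : R := g 0%nat + g 1%nat + g 2%nat.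

(* a 3x3 matrix-valued function: entries A i j, i j in {0,1,2} *)
Definition mfun3 := nat -> nat -> fun3.

Definition unif_elliptic (A : mfun3) : Prop :=
  exists Lam, 1 <= Lam /\
    forall x y t (xi : nat -> R),
      / Lam * sum3 (fun i => xi i ^ 2)
        <= sum3 (fun i => sum3 (fun j => xi i * A i j x y t * xi j))
      /\ sum3 (fun i => sum3 (fun j => xi i * A i j x y t * xi j))
        <= Lam * sum3 (fun i => xi i ^ 2).

Definition div_A_grad (A : mfun3) (u : fun3) : fun3 :=
  fun x y t =>
    sum3 (fun i => pd i (fun x' y' t' => sum3 (fun j => A i j x' y' t' * pd j u x' y' t')) x y t).

(* Main.v *)
(* Take a function equal to [cos (k z) f(t)] with [z] alternately [x] and [y] and with frequency [k]
   doubled at each unit step of [|t|]; a mode of frequency [k] decays at a rate comparable with [k],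
   so the doubling produces double exponential decay.  Between two steps the new mode
   [v = cos (2k y) g(t)] is brought in by a cutoff while the old mode [u = cos (k x) f(t)] dominates
   it by a factor [exp (c k)], the diagonal coefficients are such that [v] decays more slowly than
   [u] for a while, both being exact solutions, and [u] is cut off once [v] dominates.  The error
   made by cutting off the small mode is [cos (2k y) h(t)], with [h] exponentially small compared
   with the dominating mode, whose gradient never vanishes; hence it is the divergence of [B grad]
   applied to the solution for a non-symmetric [B] with exponentially small [C^1] norm.  All the
   profiles are Gaussian, [f = exp (- N k (t - t_k)^2 / 2)].  Ellipticity where [f''/f < 0], near
   [t = 0], is where [mu > 0] is used; the solution is then reflected in [t]. *)
Require Import Defs.
From Stdlib Require Import Reals.
From Coquelicot Require Import Coquelicot.
From Stdlib Require Import Lra Lia Psatz ZArith.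
Open Scope R_scope.

(** * A smooth step *)

(** Alternating the variables decouples the modes: [A 0 0] acts only on the mode in x and [A 1 1]
    only on the mode in y, so both can be exact at once with independently prescribed decay. For a
    Gaussian the coefficient that makes the mode exact is a quadratic polynomial in t, bounded
    independently of k on an interval of fixed length; moving the centre forward at each doubling is
    what lets the higher frequency decay more slowly for a while. To absorb the error of a mode in
    x, only the entries of the first row that meet the y and t derivatives are used, so [A 0 0]
    stays free. Weighting them by sin (l y) and cos (l y), where l is the frequency of the
    dominating mode, makes sin^2 + cos^2 = 1 do the work of a division by the squared gradient; the
    small mode leaves only a denominator close to 1. The coefficient of the second t derivative is
    1/N^2. The diagonal then stays of order one while the modes decay at rates comparable with N k,
    and for large N the factor exp (- N k) beats the ellipticity constant 1/N^2 already at k = 1. *)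

Definition sqpos (x : R) : R := Rmax x 0 ^ 2.

Lemma sqpos_neg x : x <= 0 -> sqpos x = 0.
Proof. intros H; unfold sqpos; rewrite Rmax_right by lra; ring. Qed.

Lemma sqpos_pos x : 0 <= x -> sqpos x = x ^ 2.
Proof. intros H; unfold sqpos; rewrite Rmax_left by lra; ring. Qed.

Lemma is_derive_sqpos x : is_derive sqpos x (2 * Rmax x 0).
Proof.
destruct (Rtotal_order x 0) as [H|[H|H]].
- apply (is_derive_ext_loc (fun _ => 0)).
  + exists (mkposreal (-x) ltac:(lra)); intros y Hy.
    apply Rabs_def2 in Hy; simpl in Hy; unfold minus, plus, opp in Hy; simpl in Hy.
    rewrite sqpos_neg by lra; reflexivity.
  + rewrite Rmax_right by lra; rewrite Rmult_0_r; apply (@is_derive_const R_AbsRing).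
- subst x; rewrite Rmax_left, Rmult_0_r by lra.
  apply is_derive_Reals; intros eps Heps; exists (mkposreal eps Heps).
  intros h Hh Hlt; simpl in Hlt; rewrite (sqpos_neg 0) by lra; rewrite Rplus_0_l, !Rminus_0_r.
  destruct (Rle_dec 0 h) as [H|H].
  + rewrite sqpos_pos by lra; replace (h ^ 2 / h) with h by (field; lra); lra.
  + rewrite sqpos_neg by lra; unfold Rdiv; rewrite Rmult_0_l, Rabs_R0; lra.
- apply (is_derive_ext_loc (fun y => y ^ 2)).
  + exists (mkposreal x H); intros y Hy.
    apply Rabs_def2 in Hy; simpl in Hy; unfold minus, plus, opp in Hy; simpl in Hy.
    rewrite sqpos_pos by lra; reflexivity.
  + rewrite Rmax_left by lra; auto_derive; auto; ring.
Qed.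

Lemma continuous_Rmax0 x : continuous (fun y => Rmax y 0) x.
Proof.
apply (continuous_ext (fun y => (y + Rabs y) / 2)).
- intros y; unfold Rmax, Rabs; destruct (Rle_dec y 0), (Rcase_abs y); lra.
- apply (continuous_mult (K := R_AbsRing)); [|apply continuous_const].
  apply (continuous_plus (V := R_NormedModule)); [apply continuous_id|].
  apply continuous_Rabs.
Qed.

Lemma bounded_of_compact_support (h : R -> R) :
  (forall x, continuous h x) -> (forall x, x <= 0 \/ 1 <= x -> h x = 0) ->
  exists K, forall x, Rabs (h x) <= K.
Proof.
intros Hc H0.
assert (Hc' : forall c, 0 <= c <= 1 -> continuity_pt (fun x => Rabs (h x)) c).
{ intros c _; apply continuity_pt_filterlim.
  apply (continuous_comp h Rabs); [apply Hc|apply continuous_Rabs]. }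
destruct (continuity_ab_maj _ 0 1 ltac:(lra) Hc') as [m [Hm _]].
exists (Rabs (h m)); intros x.
destruct (Rle_dec x 0) as [H|H]; [rewrite H0 by lra; rewrite Rabs_R0; apply Rabs_pos|].
destruct (Rle_dec 1 x) as [H'|H']; [rewrite H0 by lra; rewrite Rabs_R0; apply Rabs_pos|].
apply Hm; lra.
Qed.

(** On [0, 1] this is the polynomial 35 x^4 - 84 x^5 + 70 x^6 - 20 x^7, whose derivative is 140 x^3
    (1 - x)^3; the second summand is 1 minus that polynomial, present only for x > 1. Class C^3 is
    needed because second derivatives of cutoffs enter the matrix, which has to be C^1. *)
Definition st (x : R) : R :=
  sqpos x ^ 2 * (35 - 84 * x + 70 * x ^ 2 - 20 * x ^ 3)
  + sqpos (x - 1) ^ 2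
    * (35 + 84 * (x - 1) + 70 * (x - 1) ^ 2 + 20 * (x - 1) ^ 3).
Definition st1 (x : R) : R :=
  140 * (x * sqpos x * (1 - x) ^ 3 + (x - 1) * sqpos (x - 1) * x ^ 3).
Definition st2 (x : R) : R :=
  420 * (sqpos x * (1 - x) ^ 3 - x * sqpos x * (1 - x) ^ 2
         + sqpos (x - 1) * x ^ 3 + (x - 1) * sqpos (x - 1) * x ^ 2).
Definition st3 (x : R) : R :=
  420 * (2 * Rmax x 0 * (1 - x) ^ 3 - 6 * sqpos x * (1 - x) ^ 2
         + 2 * x * sqpos x * (1 - x)
         + 2 * Rmax (x - 1) 0 * x ^ 3 + 6 * sqpos (x - 1) * x ^ 2
         + 2 * (x - 1) * sqpos (x - 1) * x).

Ltac derive_sqpos x :=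
  assert (ex_derive sqpos x) by (eexists; apply is_derive_sqpos);
  assert (ex_derive sqpos (x + - (1))) by (eexists; apply is_derive_sqpos);
  auto_derive; [repeat split; auto|];
  change (fun u : R => sqpos u) with sqpos;
  rewrite ?(is_derive_unique _ _ _ (is_derive_sqpos x)),
    ?(is_derive_unique _ _ _ (is_derive_sqpos (x + - (1))));
  unfold sqpos, Rminus;
  destruct (Rle_dec x 0); [rewrite !(Rmax_right x 0) by lra|rewrite !(Rmax_left x 0) by lra];
  (destruct (Rle_dec x 1); [rewrite !(Rmax_right (x + - (1)) 0) by lra
                           |rewrite !(Rmax_left (x + - (1)) 0) by lra]); first [ring|exfalso; lra].

Lemma is_derive_st x : is_derive st x (st1 x).
Proof. unfold st, st1, Rminus; derive_sqpos x. Qed.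

Lemma is_derive_st1 x : is_derive st1 x (st2 x).
Proof. unfold st1, st2, Rminus; derive_sqpos x. Qed.

Lemma is_derive_st2 x : is_derive st2 x (st3 x).
Proof. unfold st2, st3, Rminus; derive_sqpos x. Qed.

Lemma continuous_of_derive (h : R -> R) x l : is_derive h x l -> continuous h x.
Proof. intros H; apply (ex_derive_continuous h); exists l; exact H. Qed.

Lemma continuous_st3 x : continuous st3 x.
Proof.
assert (P : forall c y, continuous (fun x => Rmax (x + c) 0) y).
{ intros c y; apply (continuous_comp (fun x => x + c) (fun x => Rmax x 0)).
  - apply (continuous_of_derive _ _ 1); auto_derive; auto; ring.
  - apply continuous_Rmax0. }
assert (Q : forall c y, continuous (fun x => sqpos (x + c)) y).
{ intros c y; apply (continuous_comp (fun x => x + c) sqpos).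
  - apply (continuous_of_derive _ _ 1); auto_derive; auto; ring.
  - eapply continuous_of_derive, is_derive_sqpos. }
unfold st3, Rminus.
assert (P0 := continuous_Rmax0).
assert (Q0 : forall y, continuous sqpos y)
  by (intros; eapply continuous_of_derive, is_derive_sqpos).
simpl pow.
repeat match goal with
| |- continuous (fun _ => ?c) _ => apply continuous_const
| |- continuous (fun x => x) _ => apply continuous_id
| |- continuous (fun x => sqpos x) _ => apply Q0
| |- continuous (fun x => sqpos (x + ?c)) _ => apply Q
| |- continuous (fun x => Rmax (x + ?c) 0) _ => apply P
| |- continuous (fun x => Rmax x 0) _ => apply P0
| |- continuous (fun x => @?a x + @?b x) _ => apply (continuous_plus (V := R_NormedModule) a b)
| |- continuous (fun x => @?a x * @?b x) _ => apply (continuous_mult (K := R_AbsRing) a b)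
| |- continuous (fun x => - @?a x) _ => apply (continuous_opp (V := R_NormedModule) a)
end.
Qed.

Ltac st_out x :=
  unfold st, st1, st2, st3, sqpos; intros H;
  first [rewrite !(Rmax_right x 0) by lra|rewrite !(Rmax_left x 0) by lra];
  first [rewrite !(Rmax_right (x - 1) 0) by lra|rewrite !(Rmax_left (x - 1) 0) by lra]; ring.

Lemma st_le0 x : x <= 0 -> st x = 0.
Proof. st_out x. Qed.
Lemma st_ge1 x : 1 <= x -> st x = 1.
Proof. st_out x. Qed.
Lemma st1_out x : x <= 0 \/ 1 <= x -> st1 x = 0.
Proof. intros [H|H]; revert H; st_out x. Qed.
Lemma st2_out x : x <= 0 \/ 1 <= x -> st2 x = 0.
Proof. intros [H|H]; revert H; st_out x. Qed.
Lemma st3_out x : x <= 0 \/ 1 <= x -> st3 x = 0.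
Proof. intros [H|H]; revert H; st_out x. Qed.

Lemma st_range x : 0 <= st x <= 1.
Proof.
destruct (Rle_dec x 0) as [H|H]; [rewrite st_le0 by lra; lra|].
destruct (Rle_dec 1 x) as [H'|H']; [rewrite st_ge1 by lra; lra|].
assert (E : st x = (x ^ 2) ^ 2 * (35 - 84 * x + 70 * x ^ 2 - 20 * x ^ 3)).
{ unfold st; rewrite (sqpos_neg (x - 1)), (sqpos_pos x) by lra; ring. }
rewrite E; set (y := 1 - x).
assert (0 < y) by (unfold y; lra).
assert (0 <= y ^ 2 /\ 0 <= y ^ 3 /\ 0 <= x ^ 2 /\ 0 <= x ^ 3)
  by (repeat split; apply pow_le; lra).
assert (0 <= (y ^ 2) ^ 2 /\ 0 <= (x ^ 2) ^ 2) by (split; apply pow2_ge_0).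
split.
- apply Rmult_le_pos; [tauto|].
  replace (35 - 84 * x + 70 * x ^ 2 - 20 * x ^ 3) with (1 + 4 * y + 10 * y ^ 2 + 20 * y ^ 3)
    by (unfold y; ring); lra.
- apply Rminus_le_0.
  replace (1 - _) with ((y ^ 2) ^ 2 * (1 + 4 * x + 10 * x ^ 2 + 20 * x ^ 3))
    by (unfold y; ring).
  apply Rmult_le_pos; [tauto|lra].
Qed.

Lemma st_bounds : exists K, 1 <= K /\ forall x,
  Rabs (st x) <= 1 /\ Rabs (st1 x) <= K /\ Rabs (st2 x) <= K /\ Rabs (st3 x) <= K.
Proof.
destruct (bounded_of_compact_support st1) as [K1 H1];
  [intros; eapply continuous_of_derive, is_derive_st1|apply st1_out|].
destruct (bounded_of_compact_support st2) as [K2 H2];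
  [intros; eapply continuous_of_derive, is_derive_st2|apply st2_out|].
destruct (bounded_of_compact_support st3) as [K3 H3];
  [intros; apply continuous_st3|apply st3_out|].
assert (P1 := Rle_trans _ _ _ (Rabs_pos _) (H1 0)).
assert (P2 := Rle_trans _ _ _ (Rabs_pos _) (H2 0)).
assert (P3 := Rle_trans _ _ _ (Rabs_pos _) (H3 0)).
exists (1 + K1 + K2 + K3); split; [lra|].
intros x; specialize (H1 x); specialize (H2 x); specialize (H3 x).
assert (R := st_range x); repeat split; try lra.
apply Rabs_le; lra.
Qed.

(** * C^1 functions on slabs, with bounds *)

Definition unc (f : fun3) (p : R * R * R) : R := f (fst (fst p)) (snd (fst p)) (snd p).

Definition cont (f : fun3) (x y t : R) : Prop := continuous (unc f) (x, y, t).

Lemma continuous3_cont f : (forall x y t, cont f x y t) -> continuous3 f.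
Proof.
intros H x y t eps Heps.
destruct (proj1 (filterlim_locally _ _) (H x y t) (mkposreal eps Heps)) as [d Hd].
exists d; split; [apply cond_pos|]; intros x' y' t' Hx Hy Ht.
apply (Hd (x', y', t')); repeat split; assumption.
Qed.

Lemma cont_ext_loc (U : R -> Prop) f g x y t : open U -> U t ->
  (forall x y t, U t -> f x y t = g x y t) -> cont g x y t -> cont f x y t.
Proof.
intros HU Ht E; apply continuous_ext_loc.
assert (L : locally (x, y, t) (fun p : R * R * R => U (snd p))).
{ apply (continuous_snd (x, y) t U), HU, Ht. }
revert L; apply filter_imp; intros [[x' y'] t'] H; symmetry; apply E, H.
Qed.

(** The bounds are explicit parameters so that their independence of the frequency can be followed
    through sums, products and inverses. [U] restricts [t] only, and the partial derivatives are
    witnesses, which spares every use of [Derive] until the end. *)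
Definition C1b (U : R -> Prop) (m0 m1 : R) (f : fun3) : Prop :=
  exists df : nat -> fun3, forall x y t, U t ->
    Rabs (f x y t) <= m0 /\ cont f x y t /\
    forall i, (i < 3)%nat ->
      is_derive (slice i f x y t) (coord i x y t) (df i x y t) /\
      Rabs (df i x y t) <= m1 /\ cont (df i) x y t.

Lemma C1b_weaken U m0 m1 n0 n1 f : m0 <= n0 -> m1 <= n1 -> C1b U m0 m1 f -> C1b U n0 n1 f.
Proof.
intros H0 H1 [df H]; exists df; intros x y t Ht.
destruct (H x y t Ht) as [A [B C]]; split; [lra|split; [exact B|]].
intros i Hi; destruct (C i Hi) as [D [E F]]; split; [exact D|split; [lra|exact F]].
Qed.

Lemma C1b_ext (U : R -> Prop) m0 m1 f g : open U ->
  (forall x y t, U t -> f x y t = g x y t) -> C1b U m0 m1 g -> C1b U m0 m1 f.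
Proof.
intros HU E [df H]; exists df; intros x y t Ht.
destruct (H x y t Ht) as [A [B C]].
rewrite E by assumption; split; [exact A|split; [exact (cont_ext_loc U f g x y t HU Ht E B)|]].
intros i Hi; destruct (C i Hi) as [D F]; split; [|exact F].
revert D; apply is_derive_ext_loc.
destruct i as [|[|i]]; simpl.
- apply filter_forall; intros s; symmetry; apply E, Ht.
- apply filter_forall; intros s; symmetry; apply E, Ht.
- apply (filter_imp U); [|apply HU, Ht]; intros s Hs; symmetry; apply E, Hs.
Qed.

(** Continuity and differentiability are local; boundedness is global only because the same [m0] and
    [m1] serve all the slabs. *)
Lemma C1b_unif_C1 f m0 m1 :
  (forall t0, exists U, open U /\ U t0 /\ C1b U m0 m1 f) -> unif_C1 f.
Proof.
intros H; split; [|split].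
- apply continuous3_cont; intros x y t; destruct (H t) as [U [_ [Ht [df F]]]].
  apply (F x y t Ht).
- exists m0; intros x y t; destruct (H t) as [U [_ [Ht [df F]]]]; apply (F x y t Ht).
- intros i Hi; split; [|split].
  + intros x y t; destruct (H t) as [U [_ [Ht [df F]]]].
    exists (df i x y t); apply (F x y t Ht), Hi.
  + apply continuous3_cont; intros x y t; destruct (H t) as [U [HU [Ht [df F]]]].
    apply (cont_ext_loc U _ (df i) x y t HU Ht); [|apply (F x y t Ht), Hi].
    intros x' y' t' Ht'; apply is_derive_unique, (F x' y' t' Ht'), Hi.
  + exists m1; intros x y t; destruct (H t) as [U [HU [Ht [df F]]]].
    unfold pd; rewrite (is_derive_unique _ _ _ (proj1 (proj2 (proj2 (F x y t Ht)) i Hi))).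
    apply (F x y t Ht), Hi.
Qed.

Lemma cont_plus f g x y t : cont f x y t -> cont g x y t ->
  cont (fun x y t => f x y t + g x y t) x y t.
Proof. apply (continuous_plus (V := R_NormedModule) (unc f) (unc g)). Qed.

Lemma cont_mult f g x y t : cont f x y t -> cont g x y t ->
  cont (fun x y t => f x y t * g x y t) x y t.
Proof. apply (continuous_mult (K := R_AbsRing) (unc f) (unc g)). Qed.

Lemma cont_const c x y t : cont (fun _ _ _ => c) x y t.
Proof. apply continuous_const. Qed.

Lemma cont_inv f x y t : f x y t <> 0 -> cont f x y t -> cont (fun x y t => / f x y t) x y t.
Proof. intros H0 H; apply (continuous_comp (unc f) Rinv _ H), continuous_Rinv, H0. Qed.

Lemma cont_x h x y t : continuous h x -> cont (fun x _ _ => h x) x y t.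
Proof.
intros H; apply (continuous_comp (fun p : R * R * R => fst (fst p)) h); [|exact H].
apply (continuous_comp (fun p : R * R * R => fst p) fst); [|apply continuous_fst].
apply continuous_fst.
Qed.

Lemma cont_y h x y t : continuous h y -> cont (fun _ y _ => h y) x y t.
Proof.
intros H; apply (continuous_comp (fun p : R * R * R => snd (fst p)) h); [|exact H].
apply (continuous_comp (fun p : R * R * R => fst p) snd); [|apply continuous_snd].
apply continuous_fst.
Qed.

Lemma cont_t h x y t : continuous h t -> cont (fun _ _ t => h t) x y t.
Proof.
intros H; apply (continuous_comp (fun p : R * R * R => snd p) h); [|exact H].
apply continuous_snd.
Qed.

Lemma C1b_const U c : C1b U (Rabs c) 0 (fun _ _ _ => c).
Proof.
exists (fun _ _ _ _ => 0); intros x y t _; split; [lra|split; [apply cont_const|]].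
intros i _; rewrite Rabs_R0; split; [|split; [lra|apply cont_const]].
destruct i as [|[|i]]; apply (@is_derive_const R_AbsRing).
Qed.

Lemma C1b_plus U m0 m1 n0 n1 f g : C1b U m0 m1 f -> C1b U n0 n1 g ->
  C1b U (m0 + n0) (m1 + n1) (fun x y t => f x y t + g x y t).
Proof.
intros [df F] [dg G]; exists (fun i x y t => df i x y t + dg i x y t); intros x y t Ht.
destruct (F x y t Ht) as [F0 [F1 F2]], (G x y t Ht) as [G0 [G1 G2]].
split; [eapply Rle_trans; [apply Rabs_triang|lra]|split; [apply cont_plus; assumption|]].
intros i Hi; destruct (F2 i Hi) as [F3 [F4 F5]], (G2 i Hi) as [G3 [G4 G5]].
split; [|split; [eapply Rle_trans; [apply Rabs_triang|lra]|apply cont_plus; assumption]].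
destruct i as [|[|i]]; apply (is_derive_plus (V := R_NormedModule) _ _ _ _ _ F3 G3).
Qed.

Lemma C1b_mult U m0 m1 n0 n1 f g : C1b U m0 m1 f -> C1b U n0 n1 g ->
  C1b U (m0 * n0) (m1 * n0 + m0 * n1) (fun x y t => f x y t * g x y t).
Proof.
intros [df F] [dg G].
exists (fun i x y t => df i x y t * g x y t + f x y t * dg i x y t); intros x y t Ht.
destruct (F x y t Ht) as [F0 [F1 F2]], (G x y t Ht) as [G0 [G1 G2]].
assert (M : forall a b a' b', Rabs a <= a' -> Rabs b <= b' -> Rabs (a * b) <= a' * b').
{ intros; rewrite Rabs_mult; apply Rmult_le_compat; auto using Rabs_pos. }
split; [apply M; assumption|split; [apply cont_mult; assumption|]].
intros i Hi; destruct (F2 i Hi) as [F3 [F4 F5]], (G2 i Hi) as [G3 [G4 G5]].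
split; [|split].
- assert (C : forall n m : R, n * m = m * n) by (intros; ring).
  destruct i as [|[|i]]; apply (is_derive_mult (K := R_AbsRing) _ _ _ _ _ F3 G3 C).
- eapply Rle_trans; [apply Rabs_triang|apply Rplus_le_compat; apply M; assumption].
- apply cont_plus; apply cont_mult; assumption.
Qed.

Lemma C1b_inv U m0 m1 d f : 0 < d -> (forall x y t, U t -> d <= f x y t) -> C1b U m0 m1 f ->
  C1b U (/ d) (m1 / d ^ 2) (fun x y t => / f x y t).
Proof.
intros Hd Hf [df F]; exists (fun i x y t => - df i x y t / f x y t ^ 2); intros x y t Ht.
destruct (F x y t Ht) as [F0 [F1 F2]]; assert (Hp := Hf x y t Ht).
split; [|split].
- rewrite Rabs_pos_eq by (apply Rlt_le, Rinv_0_lt_compat; lra).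
  apply Rinv_le_contravar; lra.
- apply cont_inv; [lra|exact F1].
- intros i Hi; destruct (F2 i Hi) as [F3 [F4 F5]]; split; [|split].
  + destruct i as [|[|i]]; apply (is_derive_inv _ _ _ F3); simpl; lra.
  + unfold Rdiv; rewrite Rabs_mult, Rabs_Ropp.
    apply Rmult_le_compat; auto using Rabs_pos.
    assert (0 < d ^ 2) by (apply pow_lt; lra).
    assert (d ^ 2 <= f x y t ^ 2) by (apply pow_incr; lra).
    rewrite Rabs_pos_eq by (apply Rlt_le, Rinv_0_lt_compat; lra).
    apply Rinv_le_contravar; lra.
  + assert (E : forall x' y' t', - df i x' y' t' / f x' y' t' ^ 2
       = (-1 * df i x' y' t') * (/ f x' y' t' * / f x' y' t')).
    { intros x' y' t'; unfold Rdiv; simpl; rewrite Rmult_1_r, Rinv_mult; ring. }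
    apply (continuous_ext (unc (fun x' y' t' => (-1 * df i x' y' t') * (/ f x' y' t' * / f x' y' t')))).
    { intros [[x' y'] t']; symmetry; apply E. }
    apply cont_mult; [apply cont_mult; [apply cont_const|exact F5]|].
    apply cont_mult; apply cont_inv; try lra; assumption.
Qed.

Lemma C1b_x U m0 m1 (h h' : R -> R) :
  (forall s, is_derive h s (h' s) /\ continuous h' s /\ Rabs (h s) <= m0 /\ Rabs (h' s) <= m1) ->
  0 <= m1 -> C1b U m0 m1 (fun x _ _ => h x).
Proof.
intros H Hm; exists (fun i x y t => match i with 0%nat => h' x | _ => 0 end); intros x y t _.
destruct (H x) as [A [B [C D]]].
split; [exact C|split; [eapply cont_x, continuous_of_derive, A|]].
intros [|[|i]] _; simpl.
- split; [exact A|split; [exact D|apply cont_x, B]].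
- split; [apply (@is_derive_const R_AbsRing)|split; [rewrite Rabs_R0; exact Hm|apply cont_const]].
- split; [apply (@is_derive_const R_AbsRing)|split; [rewrite Rabs_R0; exact Hm|apply cont_const]].
Qed.

Lemma C1b_y U m0 m1 (h h' : R -> R) :
  (forall s, is_derive h s (h' s) /\ continuous h' s /\ Rabs (h s) <= m0 /\ Rabs (h' s) <= m1) ->
  0 <= m1 -> C1b U m0 m1 (fun _ y _ => h y).
Proof.
intros H Hm; exists (fun i x y t => match i with 1%nat => h' y | _ => 0 end); intros x y t _.
destruct (H y) as [A [B [C D]]].
split; [exact C|split; [eapply cont_y, continuous_of_derive, A|]].
intros [|[|i]] _; simpl.
- split; [apply (@is_derive_const R_AbsRing)|split; [rewrite Rabs_R0; exact Hm|apply cont_const]].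
- split; [exact A|split; [exact D|apply cont_y, B]].
- split; [apply (@is_derive_const R_AbsRing)|split; [rewrite Rabs_R0; exact Hm|apply cont_const]].
Qed.

Lemma C1b_t (U : R -> Prop) m0 m1 (h h' : R -> R) :
  (forall s, U s ->
     is_derive h s (h' s) /\ continuous h' s /\ Rabs (h s) <= m0 /\ Rabs (h' s) <= m1) ->
  0 <= m1 -> C1b U m0 m1 (fun _ _ t => h t).
Proof.
intros H Hm; exists (fun i x y t => match i with 0%nat | 1%nat => 0 | _ => h' t end).
intros x y t Ht; destruct (H t Ht) as [A [B [C D]]].
split; [exact C|split; [eapply cont_t, continuous_of_derive, A|]].
intros [|[|i]] _; simpl.
- split; [apply (@is_derive_const R_AbsRing)|split; [rewrite Rabs_R0; exact Hm|apply cont_const]].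
- split; [apply (@is_derive_const R_AbsRing)|split; [rewrite Rabs_R0; exact Hm|apply cont_const]].
- split; [exact A|split; [exact D|apply cont_t, B]].
Qed.

(* [r = 1] or [r = -1]: a translation of [t], composed with a reflection. *)
Lemma C1b_pull U m0 m1 r tau f : r * r = 1 -> C1b U m0 m1 f ->
  C1b (fun t => U (r * t - tau)) m0 m1 (fun x y t => f x y (r * t - tau)).
Proof.
intros Hr [df F].
exists (fun i x y t => (match i with 0%nat | 1%nat => 1 | _ => r end) * df i x y (r * t - tau)).
intros x y t Ht; destruct (F x y _ Ht) as [A _]; split; [exact A|].
assert (Ra : Rabs r = 1).
{ unfold Rabs; destruct (Rcase_abs r); nra. }
assert (CC : forall g, cont g x y (r * t - tau) -> cont (fun x y t => g x y (r * t - tau)) x y t).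
{ intros g Hg.
  apply (continuous_comp (fun p : R * R * R => (fst p, r * snd p - tau)) (unc g)); [|exact Hg].
  apply (continuous_comp_2 (fun p : R * R * R => fst p) (fun p => r * snd p - tau) pair).
  - apply continuous_fst.
  - apply (continuous_comp (fun p : R * R * R => snd p) (fun s => r * s - tau));
      [apply continuous_snd|].
    apply (continuous_of_derive _ _ r); auto_derive; auto; ring.
  - apply (continuous_ext (fun p => p)); [intros [? ?]; reflexivity|apply continuous_id]. }
split; [apply CC, (F x y _ Ht)|].
intros i Hi; destruct (F x y _ Ht) as [_ [_ G]]; destruct (G i Hi) as [D [E C]].
split; [|split].
- destruct i as [|[|i]]; simpl in *.
  + rewrite Rmult_1_l; exact D.
  + rewrite Rmult_1_l; exact D.
  + apply (is_derive_comp (fun s => f x y s) (fun t => r * t - tau)); [exact D|].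
    auto_derive; auto; ring.
- rewrite Rabs_mult; destruct i as [|[|i]]; rewrite ?Ra, ?Rabs_R1; lra.
- apply cont_mult; [apply cont_const|apply (CC (df i)), C].
Qed.

(** * Two superposed modes *)

(* Two modes [cos (kx x) fx] and [cos (ky y) fy]; [fx1], [fx2] stand for the derivatives of [fx],
   [cx] is the coefficient [A 0 0], and [qx], [wx], [vx] enter the entries [A 0 1], [A 0 2]. *)
Record profile := mkProfile {
  kx : R; fx : R -> R; fx1 : R -> R; fx2 : R -> R; cx : R -> R;
  qx : R -> R; wx : R -> R; vx : R -> R;
  ky : R; fy : R -> R; fy1 : R -> R; fy2 : R -> R; cy : R -> R;
  qy : R -> R; wy : R -> R; vy : R -> R }.

Definition sol (d : profile) : fun3 :=
  fun x y t => cos (kx d * x) * fx d t + cos (ky d * y) * fy d t.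

Definition dsol (d : profile) (i : nat) : fun3 :=
  match i with
  | 0%nat => fun x y t => (- kx d * sin (kx d * x)) * fx d t
  | 1%nat => fun x y t => (- ky d * sin (ky d * y)) * fy d t
  | _ => fun x y t => cos (kx d * x) * fx1 d t + cos (ky d * y) * fy1 d t
  end.

(** The denominator compensates for the mode being corrected, whose own t derivative adds to that of
    the dominating mode; [w] is the ratio of these two derivatives. *)
Definition entry (p q : R -> R) (k l : R) (e w : R -> R) : fun3 := fun x y t =>
  e t * p (k * x) * q (l * y) * / (1 + w t * cos (k * x) * cos (l * y)).

Definition coeff (kappa : R) (d : profile) : mfun3 := fun i j =>
  match i, j with
  | 0%nat, 0%nat => fun _ _ t => cx d t
  | 0%nat, 1%nat => entry sin sin (kx d) (ky d) (qx d) (wx d)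
  | 0%nat, 2%nat => entry sin cos (kx d) (ky d) (fun t => qx d t * vx d t) (wx d)
  | 1%nat, 0%nat => entry sin sin (kx d) (ky d) (qy d) (wy d)
  | 1%nat, 1%nat => fun _ _ t => cy d t
  | 1%nat, 2%nat => entry cos sin (kx d) (ky d) (fun t => qy d t * vy d t) (wy d)
  | 2%nat, 2%nat => fun _ _ _ => kappa
  | _, _ => fun _ _ _ => 0
  end.

(** The weights are those under which cos (k x) f has second derivatives bounded independently of
    k. *)
Definition amp (U : R -> Prop) (M k : R) (f f1 f2 : R -> R) : Prop :=
  forall t, U t -> is_derive f t (f1 t) /\ is_derive f1 t (f2 t) /\ continuous f2 t /\
    k ^ 2 * Rabs (f t) <= M /\ k * Rabs (f1 t) <= M /\ Rabs (f2 t) <= M.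

Definition diagc (U : R -> Prop) (M lam : R) (c : R -> R) : Prop :=
  C1b U M M (fun _ _ t => c t) /\ forall t, U t -> lam <= c t.

(** The bound [lam / 16], doubled by a denominator that is at least 1/2, leaves off-diagonal entries
    below [lam / 8], small enough for ellipticity. The bound on [e0 * (w1 + k + l)] pays for
    differentiating the trigonometric factors and the denominator. *)
Definition corr (U : R -> Prop) (M lam k l : R) (e w v : R -> R) : Prop :=
  exists e0 w1, 0 <= e0 /\ 0 <= w1 /\ e0 <= lam / 16 /\ e0 * (w1 + k + l) <= M /\
    C1b U e0 M (fun _ _ t => e t) /\ C1b U (1 / 2) w1 (fun _ _ t => w t) /\
    C1b U 1 1 (fun _ _ t => v t).

(* The diagonal part of the matrix solves the equation for the mode [cos (k x) f] up to the error
   [kappa f'' - k^2 c f + mu f] on the right of the last line.  The first two lines say that the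
   off-diagonal entries, applied to the gradient of [sol], give the flux
   [- e l g sin (k x)], whose divergence cancels that error. *)
Definition balance (U : R -> Prop) (kappa mu k : R) (f f1 f2 c e w v : R -> R)
    (l : R) (g g1 : R -> R) : Prop :=
  forall t, U t ->
    e t * (v t * g1 t + l * g t) = 0 /\
    e t * (v t * f1 t + l * g t * w t) = 0 /\
    e t * k * l * g t = kappa * f2 t - k ^ 2 * c t * f t + mu * f t.

Record good (kappa mu lam M : R) (U : R -> Prop) (d : profile) : Prop := mkGood {
  g_kx : 1 <= kx d; g_ky : 1 <= ky d;
  g_ampx : amp U M (kx d) (fx d) (fx1 d) (fx2 d);
  g_ampy : amp U M (ky d) (fy d) (fy1 d) (fy2 d);
  g_cx : diagc U M lam (cx d); g_cy : diagc U M lam (cy d);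
  g_corrx : corr U M lam (kx d) (ky d) (qx d) (wx d) (vx d);
  g_corry : corr U M lam (ky d) (kx d) (qy d) (wy d) (vy d);
  g_balx : balance U kappa mu (kx d) (fx d) (fx1 d) (fx2 d) (cx d) (qx d) (wx d) (vx d)
             (ky d) (fy d) (fy1 d);
  g_baly : balance U kappa mu (ky d) (fy d) (fy1 d) (fy2 d) (cy d) (qy d) (wy d) (vy d)
             (kx d) (fx d) (fx1 d) }.

Lemma trig_scaled k : 1 <= k -> exists ds dc : R -> R,
  (forall s, is_derive (fun s => sin (k * s)) s (ds s) /\ continuous ds s /\
     Rabs (sin (k * s)) <= 1 /\ Rabs (ds s) <= k) /\
  (forall s, is_derive (fun s => cos (k * s)) s (dc s) /\ continuous dc s /\
     Rabs (cos (k * s)) <= 1 /\ Rabs (dc s) <= k).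
Proof.
intros Hk.
assert (Bs : forall x, Rabs (sin x) <= 1) by (intros x; apply Rabs_le, SIN_bound).
assert (Bc : forall x, Rabs (cos x) <= 1) by (intros x; apply Rabs_le, COS_bound).
exists (fun s => k * cos (k * s)), (fun s => - k * sin (k * s)).
split; intros s; (split; [auto_derive; auto; ring|split;
  [apply (ex_derive_continuous (V := R_NormedModule)); auto_derive; auto|split; auto]]);
  rewrite Rabs_mult, ?Rabs_Ropp, (Rabs_pos_eq k) by lra;
  [specialize (Bc (k * s))|specialize (Bs (k * s))]; nra.
Qed.

Lemma C1b_trig_x U k : 1 <= k ->
  C1b U 1 k (fun x _ _ => sin (k * x)) /\ C1b U 1 k (fun x _ _ => cos (k * x)).
Proof.
intros Hk; destruct (trig_scaled k Hk) as [ds [dc [Hs Hc]]].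
split; [apply (C1b_x _ _ _ _ ds Hs)|apply (C1b_x _ _ _ _ dc Hc)]; lra.
Qed.

Lemma C1b_trig_y U k : 1 <= k ->
  C1b U 1 k (fun _ y _ => sin (k * y)) /\ C1b U 1 k (fun _ y _ => cos (k * y)).
Proof.
intros Hk; destruct (trig_scaled k Hk) as [ds [dc [Hs Hc]]].
split; [apply (C1b_y _ _ _ _ ds Hs)|apply (C1b_y _ _ _ _ dc Hc)]; lra.
Qed.

Lemma half_le_denominator w a b : Rabs w <= 1 / 2 -> 1 / 2 <= 1 + w * cos a * cos b.
Proof.
intros H.
assert (Rabs (w * cos a * cos b) <= 1 / 2).
{ rewrite !Rabs_mult.
  assert (Ba : Rabs (cos a) <= 1) by apply Rabs_le, COS_bound.
  assert (Bb : Rabs (cos b) <= 1) by apply Rabs_le, COS_bound.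
  assert (P1 := Rabs_pos w); assert (P2 := Rabs_pos (cos a)); assert (P3 := Rabs_pos (cos b)).
  assert (Rabs w * Rabs (cos a) <= 1 / 2) by nra.
  assert (0 <= Rabs w * Rabs (cos a)) by nra. nra. }
assert (Q := Rabs_maj2 (w * cos a * cos b)); lra.
Qed.

Lemma C1b_entry U p q k l e w e0 e1 w1 : 1 <= k -> 1 <= l ->
  C1b U 1 k (fun x _ _ => p (k * x)) -> C1b U 1 l (fun _ y _ => q (l * y)) ->
  0 <= e0 -> 0 <= w1 ->
  C1b U e0 e1 (fun _ _ t => e t) -> C1b U (1 / 2) w1 (fun _ _ t => w t) ->
  C1b U (2 * e0) (2 * e1 + 4 * (e0 * (w1 + k + l))) (entry p q k l e w).
Proof.
intros Hk Hl Hp Hq He0 Hw1 He Hw.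
destruct (C1b_trig_x U k Hk) as [_ Cx]; destruct (C1b_trig_y U l Hl) as [_ Cy].
assert (Q := C1b_plus _ _ _ _ _ _ _ (C1b_const U 1)
  (C1b_mult _ _ _ _ _ _ _ (C1b_mult _ _ _ _ _ _ _ Hw Cx) Cy)).
apply (C1b_inv _ _ _ (1 / 2)) in Q; [|lra|].
2:{ intros x y t Ht; apply half_le_denominator; destruct Hw as [dw Hw]; apply (Hw x y t Ht). }
assert (E := C1b_mult _ _ _ _ _ _ _ (C1b_mult _ _ _ _ _ _ _
  (C1b_mult _ _ _ _ _ _ _ He Hp) Hq) Q).
revert E; apply C1b_weaken; [apply Req_le; field|].
assert (0 <= e0 * (k + l)) by nra.
field_simplify; nra.
Qed.

Lemma good_corr_bounds kappa mu lam M U d : 0 <= M -> lam <= M -> Rabs kappa <= M ->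
  good kappa mu lam M U d -> forall i j, (i < 3)%nat -> (j < 3)%nat ->
  C1b U (if Nat.eqb i j then M else lam / 8) (9 * M) (coeff kappa d i j).
Proof.
intros HM Hlam Hk G i j Hi Hj.
destruct G as [Gkx Gky _ _ [Gcx _] [Gcy _] Gex Gey _ _].
destruct Gex as [e0 [w1 [P0 [P1 [L0 [L1 [E [W V]]]]]]]].
destruct Gey as [e0' [w1' [P0' [P1' [L0' [L1' [E' [W' V']]]]]]]].
destruct (C1b_trig_x U _ Gkx) as [Sx Cx]; destruct (C1b_trig_y U _ Gky) as [Sy Cy].
assert (EV := C1b_mult _ _ _ _ _ _ _ E V); assert (EV' := C1b_mult _ _ _ _ _ _ _ E' V').
rewrite Rmult_1_r in EV, EV'.
assert (e0 <= M) by nra. assert (e0' <= M) by nra.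
destruct i as [|[|[|i]]]; [| | |lia]; (destruct j as [|[|[|j]]]; [| | |lia]); simpl.
- revert Gcx; apply C1b_weaken; lra.
- assert (T := C1b_entry U sin sin _ _ _ _ _ _ _ Gkx Gky Sx Sy P0 P1 E W).
  revert T; apply C1b_weaken; lra.
- assert (T := C1b_entry U sin cos _ _ _ _ _ _ _ Gkx Gky Sx Cy P0 P1 EV W).
  revert T; apply C1b_weaken; lra.
- assert (T := C1b_entry U sin sin _ _ _ _ _ _ _ Gkx Gky Sx Sy P0' P1' E' W').
  revert T; apply C1b_weaken; lra.
- revert Gcy; apply C1b_weaken; lra.
- assert (T := C1b_entry U cos sin _ _ _ _ _ _ _ Gkx Gky Cx Sy P0' P1' EV' W').
  revert T; apply C1b_weaken; lra.
- generalize (C1b_const U 0); apply C1b_weaken; rewrite ?Rabs_R0; lra.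
- generalize (C1b_const U 0); apply C1b_weaken; rewrite ?Rabs_R0; lra.
- generalize (C1b_const U kappa); apply C1b_weaken; lra.
Qed.

Lemma amp_C1b U M k f f1 f2 : 0 <= M -> 1 <= k -> amp U M k f f1 f2 ->
  C1b U (M / k ^ 2) (M / k) (fun _ _ t => f t) /\ C1b U (M / k) M (fun _ _ t => f1 t).
Proof.
intros HM Hk H.
assert (0 < k ^ 2) by (apply pow_lt; lra).
assert (0 <= M / k) by (apply Rdiv_le_0_compat; lra).
split; [apply (C1b_t U _ _ f f1)|apply (C1b_t U _ _ f1 f2)]; try assumption;
  intros t Ht; destruct (H t Ht) as [A [B [C [D [E F]]]]].
- split; [exact A|split; [eapply continuous_of_derive, B|split; apply Rle_div_r; lra]].
- split; [exact B|split; [exact C|split; [apply Rle_div_r; lra|exact F]]].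
Qed.

Lemma good_sol kappa mu lam M U d : 0 <= M -> good kappa mu lam M U d ->
  C1b U (2 * M) (4 * M) (sol d) /\
  forall i, (i < 3)%nat -> C1b U (2 * M) (4 * M) (dsol d i).
Proof.
intros HM [Gkx Gky Gx Gy _ _ _ _ _ _].
destruct (amp_C1b _ _ _ _ _ _ HM Gkx Gx) as [X0 X1], (amp_C1b _ _ _ _ _ _ HM Gky Gy) as [Y0 Y1].
destruct (C1b_trig_x U _ Gkx) as [Sx Cx]; destruct (C1b_trig_y U _ Gky) as [Sy Cy].
assert (B : forall k, 1 <= k -> 0 <= M / k <= M /\ 0 <= M / k ^ 2 <= M / k
  /\ k * (M / k) = M /\ k * (M / k ^ 2) = M / k).
{ intros k Hk; assert (0 <= M / k) by (apply Rdiv_le_0_compat; lra).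
  assert (E : k * (M / k) = M) by (field; lra).
  assert (E' : k * (M / k ^ 2) = M / k) by (field; lra).
  assert (0 <= M / k ^ 2) by (apply Rdiv_le_0_compat; [lra|apply pow_lt; lra]).
  repeat split; try assumption; nra. }
destruct (B _ Gkx) as [B1 [B2 [B3 B4]]]; destruct (B _ Gky) as [B5 [B6 [B7 B8]]].
split.
- generalize (C1b_plus _ _ _ _ _ _ _ (C1b_mult _ _ _ _ _ _ _ Cx X0) (C1b_mult _ _ _ _ _ _ _ Cy Y0)).
  apply C1b_weaken; lra.
- intros [|[|i]] _; simpl.
  + generalize (C1b_mult _ _ _ _ _ _ _ (C1b_mult _ _ _ _ _ _ _ (C1b_const U (- kx d)) Sx) X0).
    rewrite Rabs_Ropp, Rabs_pos_eq by lra; apply C1b_weaken; [lra|].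
    rewrite Rmult_0_l, Rplus_0_l, Rmult_1_r, Rmult_assoc, B4, B3; lra.
  + generalize (C1b_mult _ _ _ _ _ _ _ (C1b_mult _ _ _ _ _ _ _ (C1b_const U (- ky d)) Sy) Y0).
    rewrite Rabs_Ropp, Rabs_pos_eq by lra; apply C1b_weaken; [lra|].
    rewrite Rmult_0_l, Rplus_0_l, Rmult_1_r, Rmult_assoc, B8, B7; lra.
  + generalize (C1b_plus _ _ _ _ _ _ _ (C1b_mult _ _ _ _ _ _ _ Cx X1) (C1b_mult _ _ _ _ _ _ _ Cy Y1)).
    apply C1b_weaken; lra.
Qed.

Lemma pd_sol kappa mu lam M (U : R -> Prop) d u : open U -> good kappa mu lam M U d ->
  (forall x y t, U t -> u x y t = sol d x y t) ->
  forall i x y t, (i < 3)%nat -> U t -> pd i u x y t = dsol d i x y t.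
Proof.
intros HU G E i x y t Hi Ht; unfold pd.
destruct (g_ampx _ _ _ _ _ _ G t Ht) as [X _]; destruct (g_ampy _ _ _ _ _ _ G t Ht) as [Y _].
destruct i as [|[|i]]; simpl.
- rewrite (Derive_ext _ (fun s => sol d s y t)) by (intros; apply E, Ht).
  apply is_derive_unique; unfold sol; auto_derive; auto; ring.
- rewrite (Derive_ext _ (fun s => sol d x s t)) by (intros; apply E, Ht).
  apply is_derive_unique; unfold sol; auto_derive; auto; ring.
- rewrite (Derive_ext_loc _ (fun s => sol d x y s)).
  2:{ apply (filter_imp U); [intros; apply E; assumption|apply HU, Ht]. }
  apply is_derive_unique.
  apply (is_derive_plus (V := R_NormedModule) (fun s => cos (kx d * x) * fx d s)
    (fun s => cos (ky d * y) * fy d s)).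
  + apply is_derive_scal, X.
  + apply is_derive_scal, Y.
Qed.

(** The value of [A] applied to the gradient of [sol]. Each horizontal component depends on its own
    variable only, so that the divergence is again a combination of the two cosines. *)
Definition flux (kappa : R) (d : profile) (i : nat) : fun3 := fun x y t =>
  match i with
  | 0%nat => - (kx d * cx d t * fx d t + qx d t * ky d * fy d t) * sin (kx d * x)
  | 1%nat => - (ky d * cy d t * fy d t + qy d t * kx d * fx d t) * sin (ky d * y)
  | _ => kappa * (cos (kx d * x) * fx1 d t + cos (ky d * y) * fy1 d t)
  end.

Lemma good_small_w kappa mu lam M (U : R -> Prop) d t : good kappa mu lam M U d -> U t ->
  Rabs (wx d t) <= 1 / 2 /\ Rabs (wy d t) <= 1 / 2.
Proof.
intros [_ _ _ _ _ _ Gex Gey _ _] Ht.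
destruct Gex as [e0 [w1 [_ [_ [_ [_ [_ [[dw W] _]]]]]]]].
destruct Gey as [e0' [w1' [_ [_ [_ [_ [_ [[dw' W'] _]]]]]]]].
split; [apply (W 0 0 t Ht)|apply (W' 0 0 t Ht)].
Qed.

(** In the first row the y derivative contributes - l g sin^2 (l y) and, by the first line of
    [balance], the t derivative of the dominating mode contributes - l g cos^2 (l y): together a
    constant in y. By the second line the t derivative of the other mode contributes - l g w cos (k
    x) cos (l y), and the sum is exactly the denominator times - l g. The second row is
    symmetric. *)
Lemma coeff_dsol kappa mu lam M (U : R -> Prop) d i x y t :
  good kappa mu lam M U d -> U t -> (i < 3)%nat ->
  sum3 (fun j => coeff kappa d i j x y t * dsol d j x y t) = flux kappa d i x y t.
Proof.
intros G Ht Hi.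
destruct (good_small_w _ _ _ _ _ _ t G Ht) as [W1 W2].
assert (Q1 := half_le_denominator _ (kx d * x) (ky d * y) W1).
assert (Q2 := half_le_denominator _ (kx d * x) (ky d * y) W2).
destruct (g_balx _ _ _ _ _ _ G t Ht) as [X1 [X2 _]].
destruct (g_baly _ _ _ _ _ _ G t Ht) as [Y1 [Y2 _]].
assert (Tx := sin2_cos2 (kx d * x)); assert (Ty := sin2_cos2 (ky d * y)).
unfold Rsqr in Tx, Ty.
unfold sum3; destruct i as [|[|[|i]]]; [| | |lia]; simpl; unfold entry.
- revert Tx Ty Q1.
  generalize (cos (kx d * x)) (sin (kx d * x)) (cos (ky d * y)) (sin (ky d * y)).
  intros c s c' s' Tx Ty Q.
  assert (HI := Rinv_l (1 + wx d t * c * c') ltac:(lra)); revert HI.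
  generalize (/ (1 + wx d t * c * c')); intros I HI.
  transitivity (- kx d * cx d t * fx d t * s + s * I * (- (qx d t * ky d * fy d t) * (s' * s')
    + c' * (c * (qx d t * vx d t * fx1 d t) + c' * (qx d t * vx d t * fy1 d t)))); [ring|].
  replace (qx d t * vx d t * fy1 d t) with (- qx d t * ky d * fy d t) by lra.
  replace (qx d t * vx d t * fx1 d t) with (- qx d t * ky d * fy d t * wx d t) by lra.
  replace (s' * s') with (1 - c' * c') by lra.
  transitivity (- kx d * cx d t * fx d t * s
    - s * (qx d t * ky d * fy d t) * (I * (1 + wx d t * c * c'))); [ring|].
  rewrite HI; ring.
- revert Tx Ty Q2.
  generalize (cos (kx d * x)) (sin (kx d * x)) (cos (ky d * y)) (sin (ky d * y)).
  intros c s c' s' Tx Ty Q.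
  assert (HI := Rinv_l (1 + wy d t * c * c') ltac:(lra)); revert HI.
  generalize (/ (1 + wy d t * c * c')); intros I HI.
  transitivity (- ky d * cy d t * fy d t * s' + s' * I * (- (qy d t * kx d * fx d t) * (s * s)
    + c * (c' * (qy d t * vy d t * fy1 d t) + c * (qy d t * vy d t * fx1 d t)))); [ring|].
  replace (qy d t * vy d t * fx1 d t) with (- qy d t * kx d * fx d t) by lra.
  replace (qy d t * vy d t * fy1 d t) with (- qy d t * kx d * fx d t * wy d t) by lra.
  replace (s * s) with (1 - c * c) by lra.
  transitivity (- ky d * cy d t * fy d t * s'
    - s' * (qy d t * kx d * fx d t) * (I * (1 + wy d t * c * c'))); [ring|].
  rewrite HI; ring.
- ring.
Qed.

(** The divergence of [flux] is matched with - mu u separately on each of the two cosines; the two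
    coefficients are the last lines of the two [balance] conditions. *)
Lemma good_pde kappa mu lam M (U : R -> Prop) d (A : mfun3) u : open U ->
  good kappa mu lam M U d ->
  (forall x y t, U t -> u x y t = sol d x y t) ->
  (forall i j x y t, (i < 3)%nat -> (j < 3)%nat -> U t -> A i j x y t = coeff kappa d i j x y t) ->
  forall x y t, U t -> div_A_grad A u x y t = - mu * u x y t.
Proof.
intros HU G Eu EA x y t Ht.
assert (F : forall i x y t, (i < 3)%nat -> U t ->
  sum3 (fun j => A i j x y t * pd j u x y t) = flux kappa d i x y t).
{ intros i x' y' t' Hi Ht'; rewrite <- (coeff_dsol _ _ _ _ _ _ _ _ _ _ G Ht' Hi).
  unfold sum3; rewrite !EA by (auto; lia).
  rewrite !(pd_sol _ _ _ _ _ _ _ HU G Eu) by (auto; lia); reflexivity. }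
destruct (g_ampx _ _ _ _ _ _ G t Ht) as [_ [X _]]; destruct (g_ampy _ _ _ _ _ _ G t Ht) as [_ [Y _]].
destruct (g_balx _ _ _ _ _ _ G t Ht) as [_ [_ X3]].
destruct (g_baly _ _ _ _ _ _ G t Ht) as [_ [_ Y3]].
assert (D0 : is_derive (fun s => flux kappa d 0 s y t) x
  (- (kx d * cx d t * fx d t + qx d t * ky d * fy d t) * (kx d * cos (kx d * x))))
  by (unfold flux; auto_derive; auto; ring).
assert (D1 : is_derive (fun s => flux kappa d 1 x s t) y
  (- (ky d * cy d t * fy d t + qy d t * kx d * fx d t) * (ky d * cos (ky d * y))))
  by (unfold flux; auto_derive; auto; ring).
assert (D2 : is_derive (fun s => flux kappa d 2 x y s) t
  (kappa * (cos (kx d * x) * fx2 d t + cos (ky d * y) * fy2 d t))).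
{ apply is_derive_scal.
  apply (is_derive_plus (V := R_NormedModule) (fun s => cos (kx d * x) * fx1 d s)
    (fun s => cos (ky d * y) * fy1 d s)).
  - apply is_derive_scal, X.
  - apply is_derive_scal, Y. }
set (Fl := fun i x' y' t' => sum3 (fun j => A i j x' y' t' * pd j u x' y' t')) in *.
(* Derivatives in x and y stay at the same [t], so [flux] may be substituted along the whole line;
   only the t derivative below needs [U] to be open. *)
assert (P0 := fun l H => eq_trans (Derive_ext (fun s => Fl 0%nat s y t) _ x (fun s => F 0%nat s y t ltac:(lia) Ht))
  (is_derive_unique _ x l H)).
assert (P1 := fun l H => eq_trans (Derive_ext (fun s => Fl 1%nat x s t) _ y (fun s => F 1%nat x s t ltac:(lia) Ht))
  (is_derive_unique _ y l H)).
assert (P2 : pd 2 (Fl 2%nat) x y t = kappa * (cos (kx d * x) * fx2 d t + cos (ky d * y) * fy2 d t)).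
{ eapply eq_trans; [|apply is_derive_unique, D2].
  apply Derive_ext_loc, (filter_imp U); [intros; apply F; auto; lia|apply HU, Ht]. }
change (pd 0 (Fl 0%nat) x y t + pd 1 (Fl 1%nat) x y t + pd 2 (Fl 2%nat) x y t = - mu * u x y t).
unfold pd at 1 2; simpl slice; simpl coord.
rewrite (P0 _ D0), (P1 _ D1), P2, Eu by assumption; unfold sol.
transitivity (cos (kx d * x) * (kappa * fx2 d t - kx d ^ 2 * cx d t * fx d t
    - qx d t * kx d * ky d * fy d t)
  + cos (ky d * y) * (kappa * fy2 d t - ky d ^ 2 * cy d t * fy d t
    - qy d t * ky d * kx d * fx d t)); [ring|].
rewrite X3, Y3; ring.
Qed.

(** Each off-diagonal term costs lam/16 times the sum of two squares, and each index occurs in four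
    ordered pairs, so the total loss is lam/4 of the sum of squares. No symmetry of [a] enters. *)
Lemma quadratic_form_bounds lam M (a : nat -> nat -> R) (xi : nat -> R) :
  0 < lam -> lam <= M ->
  (forall i j, (i < 3)%nat -> (j < 3)%nat -> i <> j -> Rabs (a i j) <= lam / 8) ->
  (forall i, (i < 3)%nat -> lam <= a i i <= M) ->
  lam / 2 * sum3 (fun i => xi i ^ 2) <= sum3 (fun i => sum3 (fun j => xi i * a i j * xi j))
  <= 2 * M * sum3 (fun i => xi i ^ 2).
Proof.
intros Hl HM Ho Hd.
assert (O : forall i j, (i < 3)%nat -> (j < 3)%nat -> i <> j ->
  Rabs (xi i * a i j * xi j) <= lam / 16 * (xi i ^ 2 + xi j ^ 2)).
{ intros i j Hi Hj Hij; rewrite !Rabs_mult.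
  assert (B := Ho i j Hi Hj Hij).
  rewrite <- (pow2_abs (xi i)), <- (pow2_abs (xi j)).
  assert (Pi := Rabs_pos (xi i)); assert (Pj := Rabs_pos (xi j)).
  revert Pi Pj; generalize (Rabs (xi i)) (Rabs (xi j)); intros p q Pi Pj.
  assert (p * q * Rabs (a i j) <= p * q * (lam / 8)) by (apply Rmult_le_compat_l; nra).
  assert (0 <= lam * (p - q) ^ 2) by (apply Rmult_le_pos; [lra|apply pow2_ge_0]).
  nra. }
assert (D : forall i, (i < 3)%nat -> lam * xi i ^ 2 <= xi i * a i i * xi i <= M * xi i ^ 2).
{ intros i Hi; destruct (Hd i Hi); assert (0 <= xi i ^ 2) by apply pow2_ge_0.
  replace (xi i * a i i * xi i) with (a i i * xi i ^ 2) by ring.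
  split; apply Rmult_le_compat_r; lra. }
assert (D0 := D 0%nat ltac:(lia)); assert (D1 := D 1%nat ltac:(lia)); assert (D2 := D 2%nat ltac:(lia)).
assert (O01 := proj1 (Rabs_le_between _ _) (O 0%nat 1%nat ltac:(lia) ltac:(lia) ltac:(lia))).
assert (O02 := proj1 (Rabs_le_between _ _) (O 0%nat 2%nat ltac:(lia) ltac:(lia) ltac:(lia))).
assert (O10 := proj1 (Rabs_le_between _ _) (O 1%nat 0%nat ltac:(lia) ltac:(lia) ltac:(lia))).
assert (O12 := proj1 (Rabs_le_between _ _) (O 1%nat 2%nat ltac:(lia) ltac:(lia) ltac:(lia))).
assert (O20 := proj1 (Rabs_le_between _ _) (O 2%nat 0%nat ltac:(lia) ltac:(lia) ltac:(lia))).
assert (O21 := proj1 (Rabs_le_between _ _) (O 2%nat 1%nat ltac:(lia) ltac:(lia) ltac:(lia))).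
assert (P0 := pow2_ge_0 (xi 0%nat)); assert (P1 := pow2_ge_0 (xi 1%nat));
assert (P2 := pow2_ge_0 (xi 2%nat)).
assert (lam * xi 0%nat ^ 2 <= M * xi 0%nat ^ 2) by (apply Rmult_le_compat_r; lra).
assert (lam * xi 1%nat ^ 2 <= M * xi 1%nat ^ 2) by (apply Rmult_le_compat_r; lra).
assert (lam * xi 2%nat ^ 2 <= M * xi 2%nat ^ 2) by (apply Rmult_le_compat_r; lra).
assert (0 <= lam * xi 0%nat ^ 2) by (apply Rmult_le_pos; lra).
assert (0 <= lam * xi 1%nat ^ 2) by (apply Rmult_le_pos; lra).
assert (0 <= lam * xi 2%nat ^ 2) by (apply Rmult_le_pos; lra).
unfold sum3; split; lra.
Qed.

(** * The transition from one frequency to the next *)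

(** At every other transition the low frequency is carried by y; [swap] lets one formula serve both
    parities. *)
Definition swap (d : profile) : profile :=
  mkProfile (ky d) (fy d) (fy1 d) (fy2 d) (cy d) (qy d) (wy d) (vy d)
            (kx d) (fx d) (fx1 d) (fx2 d) (cx d) (qx d) (wx d) (vx d).

Lemma good_swap kappa mu lam M U d : good kappa mu lam M U d -> good kappa mu lam M U (swap d).
Proof. intros []; constructor; assumption. Qed.

(** First derivatives change sign under reflection. So do [vx] and [vy], which stand for - l g / g1,
    while [wx] and [wy], quotients of two first derivatives, do not. *)
Definition pull (r tau : R) (d : profile) : profile :=
  mkProfile (kx d) (fun t => fx d (r * t - tau)) (fun t => r * fx1 d (r * t - tau))
    (fun t => fx2 d (r * t - tau)) (fun t => cx d (r * t - tau))
    (fun t => qx d (r * t - tau)) (fun t => wx d (r * t - tau))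
    (fun t => r * vx d (r * t - tau))
    (ky d) (fun t => fy d (r * t - tau)) (fun t => r * fy1 d (r * t - tau))
    (fun t => fy2 d (r * t - tau)) (fun t => cy d (r * t - tau))
    (fun t => qy d (r * t - tau)) (fun t => wy d (r * t - tau))
    (fun t => r * vy d (r * t - tau)).

Lemma Rabs_sign r : r * r = 1 -> Rabs r = 1.
Proof. intros H; unfold Rabs; destruct (Rcase_abs r); nra. Qed.

Section Pull.
Context (r tau : R) (Hr : r * r = 1) (U : R -> Prop).
Let V := fun t => U (r * t - tau).

Lemma amp_pull M k f f1 f2 : amp U M k f f1 f2 ->
  amp V M k (fun t => f (r * t - tau)) (fun t => r * f1 (r * t - tau)) (fun t => f2 (r * t - tau)).
Proof.
intros H t Ht; destruct (H _ Ht) as [A [B [C [D [E F]]]]].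
assert (Af : is_derive (fun t => r * t - tau) t r) by (auto_derive; auto; ring).
split; [|split; [|split; [|split; [|split]]]]; try assumption.
- apply (is_derive_comp f (fun t => r * t - tau) _ _ _ A Af).
- evar_last.
  + apply is_derive_scal, (is_derive_comp f1 (fun t => r * t - tau) _ _ _ B Af).
  + change (r * (r * f2 (r * t - tau)) = f2 (r * t - tau)); rewrite <- Rmult_assoc, Hr; ring.
- apply (continuous_comp (fun t => r * t - tau) f2); [|exact C].
  apply (continuous_of_derive _ _ _ Af).
- rewrite Rabs_mult, (Rabs_sign r Hr), Rmult_1_l; exact E.
Qed.

Lemma diagc_pull M lam c : diagc U M lam c -> diagc V M lam (fun t => c (r * t - tau)).
Proof.
intros [A B]; split; [|intros t Ht; apply B, Ht].
apply (C1b_pull _ _ _ r tau _ Hr A).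
Qed.

Lemma corr_pull M lam k l e w v : corr U M lam k l e w v ->
  corr V M lam k l (fun t => e (r * t - tau)) (fun t => w (r * t - tau))
    (fun t => r * v (r * t - tau)).
Proof.
intros [e0 [w1 [P0 [P1 [L0 [L1 [E [W Vv]]]]]]]].
exists e0, w1; do 4 (split; [assumption|]); split; [|split].
- apply (C1b_pull _ _ _ r tau _ Hr E).
- apply (C1b_pull _ _ _ r tau _ Hr W).
- generalize (C1b_mult _ _ _ _ _ _ _ (C1b_const V r) (C1b_pull _ _ _ r tau _ Hr Vv)).
  apply C1b_weaken; rewrite (Rabs_sign r Hr); lra.
Qed.

Lemma balance_pull kappa mu k f f1 f2 c e w v l g g1 :
  balance U kappa mu k f f1 f2 c e w v l g g1 ->
  balance V kappa mu k (fun t => f (r * t - tau)) (fun t => r * f1 (r * t - tau))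
    (fun t => f2 (r * t - tau)) (fun t => c (r * t - tau)) (fun t => e (r * t - tau))
    (fun t => w (r * t - tau)) (fun t => r * v (r * t - tau))
    l (fun t => g (r * t - tau)) (fun t => r * g1 (r * t - tau)).
Proof.
intros H t Ht; destruct (H _ Ht) as [A [B C]]; split; [|split; [|exact C]].
- rewrite <- A; rewrite <- (Rmult_1_l (v _ * g1 _)), <- Hr; ring.
- rewrite <- B; rewrite <- (Rmult_1_l (v _ * f1 _)), <- Hr; ring.
Qed.

Lemma good_pull kappa mu lam M d : good kappa mu lam M U d -> good kappa mu lam M V (pull r tau d).
Proof.
intros []; constructor; simpl; try assumption; auto using amp_pull, diagc_pull, corr_pull, balance_pull.
Qed.

End Pull.

(* With [X = N k], the modes of frequencies [k] (low) and [2 k] (high) are Gaussians in [z] centred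
   at [-9] and [-1], normalised so that they agree at [z = 3]; the high one decays more slowly
   for [z < 7].  [ratH] and [ratL] are the ratios [expH / expL] and [expL / expH], cut off to the
   side where they are small. *)
Definition expL (N X z : R) : R := exp (- (X * (z + 9) ^ 2 / 2) - 56 * (X - N)).
Definition expH (N X z : R) : R := exp (- (X * (z + 1) ^ 2) - 56 * (2 * X - N)).
Definition ratL (X z : R) : R := exp (X / 2 * ((z - 3) * (z - 11))) * st (2 * z - 7).
Definition ratH (X z : R) : R := exp (- (X / 2) * ((z - 3) * (z - 11))) * (1 + -1 * st (2 * z - 4)).

(* On [-1/2 < z < 17/2] the high mode is switched on for [1 < z < 2], where the low one dominates,
   and the low mode is switched off for [4 < z < 5], where the high one dominates.  For
   [2 < z < 4] both are exact solutions.  The coefficient of an absent mode is relaxed to [1]. *)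
Definition window (N mu k : R) : profile :=
  let X := N * k in
  mkProfile
    k
    (fun z => (1 - st (z - 4)) * expL N X z)
    (fun z => (- st1 (z - 4) - X * (z + 9) * (1 - st (z - 4))) * expL N X z)
    (fun z => (- st2 (z - 4) + 2 * X * (z + 9) * st1 (z - 4)
               + (X ^ 2 * (z + 9) ^ 2 - X) * (1 - st (z - 4))) * expL N X z)
    (fun z => 1 + (1 + -1 * st (2 * z - 10)) * ((z + 9) * (z + 9) + (- / X + mu * (N / X) ^ 2 - 1)))
    (fun z => / X * ((- (1 / 2) * (/ X * st2 (z - 4)) + (z + 9) * st1 (z - 4)) * ratL X z))
    (fun z => (/ X * st1 (z - 4) + (z + 9) * (1 + -1 * st (z - 4))) * (1 / 2 * / (z + 1)) * ratL X z)
    (fun z => / N * / (z + 1))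
    (2 * k)
    (fun z => st (z - 1) * expH N X z)
    (fun z => (st1 (z - 1) - 2 * X * (z + 1) * st (z - 1)) * expH N X z)
    (fun z => (st2 (z - 1) - 4 * X * (z + 1) * st1 (z - 1)
               + (4 * X ^ 2 * (z + 1) ^ 2 - 2 * X) * st (z - 1)) * expH N X z)
    (fun z => 1 + st (2 * z - 1) * ((z + 1) * (z + 1) + (- / (2 * X) + mu * (N / (2 * X)) ^ 2 - 1)))
    (fun z => / X * ((1 / 2 * (/ X * st2 (z - 1)) + -2 * ((z + 1) * st1 (z - 1))) * ratH X z))
    (fun z => (-1 * (/ X * st1 (z - 1)) + 2 * ((z + 1) * st (z - 1))) * / (z + 9) * ratH X z)
    (fun z => / N * / (z + 9)).

Definition Wz (z : R) : Prop := -1/2 < z < 17/2.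

Lemma C1b_step U (h h' : R -> R) m0 m1 a b :
  (forall x, is_derive h x (h' x)) -> (forall x, continuous h' x) ->
  (forall x, Rabs (h x) <= m0) -> (forall x, Rabs (h' x) <= m1) ->
  C1b U m0 (Rabs a * m1) (fun _ _ t => h (a * t - b)).
Proof.
intros H1 H2 H3 H4.
apply (C1b_t U _ _ (fun t => h (a * t - b)) (fun t => a * h' (a * t - b))).
- intros s _; assert (Af : is_derive (fun s => a * s - b) s a) by (auto_derive; auto; ring).
  split; [|split; [|split; [apply H3|]]].
  + apply (is_derive_comp h (fun s => a * s - b) _ _ _ (H1 _) Af).
  + apply (continuous_mult (K := R_AbsRing) (fun _ => a)); [apply continuous_const|].
    apply (continuous_comp (fun s => a * s - b) h'); [|apply H2].
    apply (continuous_of_derive _ _ _ Af).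
  + rewrite Rabs_mult; apply Rmult_le_compat_l; [apply Rabs_pos|apply H4].
- apply Rmult_le_pos; [apply Rabs_pos|].
  eapply Rle_trans; [apply Rabs_pos|apply (H4 0)].
Qed.

Lemma C1b_step1 U (h h' : R -> R) m0 m1 b :
  (forall x, is_derive h x (h' x)) -> (forall x, continuous h' x) ->
  (forall x, Rabs (h x) <= m0) -> (forall x, Rabs (h' x) <= m1) ->
  C1b U m0 m1 (fun _ _ t => h (t - b)).
Proof.
intros H1 H2 H3 H4.
apply (C1b_t U _ _ (fun t => h (t - b)) (fun t => h' (t - b))).
- intros s _; assert (Af : is_derive (fun s => s - b) s 1) by (auto_derive; auto; ring).
  split; [|split; [|split; [apply H3|apply H4]]].
  + evar_last; [apply (is_derive_comp h (fun s => s - b) _ _ _ (H1 _) Af)|apply Rmult_1_l].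
  + apply (continuous_comp (fun s => s - b) h'); [|apply H2].
    apply (continuous_of_derive _ _ _ Af).
- eapply Rle_trans; [apply Rabs_pos|apply (H4 0)].
Qed.

(** Every differentiation of a mode or of a ratio of modes costs a factor of order X; these bounds
    let the exponential smallness absorb one or two of them. *)
Lemma mul_exp_neg_le X : 0 <= X -> X * exp (- X) <= 1 /\ X ^ 2 * exp (- X) <= 4.
Proof.
intros HX.
assert (A : forall Y, 0 <= Y -> Y * exp (- Y) <= 1).
{ intros Y HY; rewrite exp_Ropp; apply Rmult_le_reg_r with (exp Y); [apply exp_pos|].
  rewrite Rmult_assoc, Rinv_l by (apply Rgt_not_eq, exp_pos).
  assert (E := exp_ineq1_le Y); lra. }
split; [apply A, HX|].
assert (H := A (X / 2) ltac:(lra)).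
replace (X ^ 2 * exp (- X)) with (4 * ((X / 2 * exp (- (X / 2))) * (X / 2 * exp (- (X / 2))))).
2:{ transitivity (X ^ 2 * (exp (- (X / 2)) * exp (- (X / 2)))); [field|].
    rewrite <- exp_plus; f_equal; f_equal; field. }
assert (0 <= X / 2 * exp (- (X / 2))) by (apply Rmult_le_pos; [lra|apply Rlt_le, exp_pos]).
nra.
Qed.

(** * Estimates on one transition, with constants independent of the frequency *)

Section Window.
Context (K N mu k : R) (HK : 1 <= K).
Context (HS : forall x,
  Rabs (st x) <= 1 /\ Rabs (st1 x) <= K /\ Rabs (st2 x) <= K /\ Rabs (st3 x) <= K).
Context (Hmu : 0 < mu) (HN : 10 <= N) (Hk : 1 <= k).
Context (HNK : exp (- N) * (336 * K * N ^ 2) <= 1).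
Let X := N * k.

Lemma X_ge : N <= X /\ k <= X /\ 10 <= X.
Proof. unfold X; repeat split; nra. Qed.

Lemma c1_st a b : C1b Wz 1 (Rabs a * K) (fun _ _ t => st (a * t - b)).
Proof.
apply (C1b_step _ st st1); try apply HS; [apply is_derive_st|].
intros; eapply continuous_of_derive, is_derive_st1.
Qed.

Lemma c1_st0 b : C1b Wz 1 K (fun _ _ t => st (t - b)).
Proof.
apply (C1b_step1 _ st st1); try apply HS; [apply is_derive_st|].
intros; eapply continuous_of_derive, is_derive_st1.
Qed.

Lemma c1_st1 b : C1b Wz K K (fun _ _ t => st1 (t - b)).
Proof.
apply (C1b_step1 _ st1 st2); try apply HS; [apply is_derive_st1|].
intros; eapply continuous_of_derive, is_derive_st2.
Qed.

Lemma c1_st2 b : C1b Wz K K (fun _ _ t => st2 (t - b)).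
Proof.
apply (C1b_step1 _ st2 st3); try apply HS; [apply is_derive_st2|apply continuous_st3].
Qed.

Lemma c1_lin c : 1 <= c <= 9 -> C1b Wz (c + 9) 1 (fun _ _ t => t + c).
Proof.
intros Hc; apply (C1b_t _ _ _ (fun t => t + c) (fun _ => 1)); [|lra].
intros s [Hs1 Hs2]; split; [auto_derive; auto; ring|split; [apply continuous_const|]].
split; apply Rabs_le; lra.
Qed.

(** The constant 21 K is the size of the correction prefactors, and 336 = 21 * 16: the hypothesis on
    [N] says that a correction of size 21 K exp (- N) stays below a sixteenth of the ellipticity
    constant 1/N^2. *)
Lemma expN_le : exp (- X) <= exp (- N) /\ 0 < exp (- X) /\ 21 * K * exp (- X) <= / (16 * N ^ 2)
  /\ 21 * K * exp (- X) <= 1 / 4 /\ exp (- X) <= 1.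
Proof.
destruct X_ge as [HX [_ HX']].
assert (E : exp (- X) <= exp (- N)).
{ destruct HX as [HX|HX]; [left; apply exp_increasing; lra|rewrite HX; lra]. }
assert (P := exp_pos (- X)); assert (P' := exp_pos (- N)).
assert (N2 : 0 < N ^ 2) by (apply pow_lt; lra).
assert (Q : 21 * K * exp (- X) <= / (16 * N ^ 2)).
{ apply Rmult_le_reg_r with (16 * N ^ 2); [lra|].
  rewrite Rinv_l by lra.
  apply Rle_trans with (exp (- N) * (336 * K * N ^ 2)); [|exact HNK].
  replace (21 * K * exp (- X) * (16 * N ^ 2)) with (exp (- X) * (336 * K * N ^ 2)) by ring.
  apply Rmult_le_compat_r; nra. }
assert (/ (16 * N ^ 2) <= 1 / 4).
{ apply Rmult_le_reg_r with (16 * N ^ 2); [lra|].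
  rewrite Rinv_l by lra; nra. }
repeat split; try assumption; try lra; nra.
Qed.

Lemma exp_le_expX y : y <= - X -> exp y <= exp (- X).
Proof. intros [H|H]; [left; apply exp_increasing, H|rewrite H; lra]. Qed.

(** The cutoff removes z >= 5/2, and for smaller z in the window (z - 3) (z - 11) is at least 2,
    which gives exp (- X). Differentiation brings out X (7 - z) <= 8 X, absorbed by X exp (- X) <=
    1. *)
Lemma c1_ratH : C1b Wz (exp (- X)) (8 + 2 * K) (fun _ _ t => ratH X t).
Proof.
destruct X_ge as [HX [_ HX']]; destruct (mul_exp_neg_le X ltac:(lra)) as [B1 _].
destruct expN_le as [_ [P [_ [_ B2]]]].
apply (C1b_t _ _ _ (ratH X) (fun z => exp (- (X / 2) * ((z - 3) * (z - 11)))
  * (X * (7 - z) * (1 + -1 * st (2 * z - 4)) - 2 * st1 (2 * z - 4)))); [|lra].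
intros z [Hz1 Hz2].
assert (D1 : ex_derive st (2 * z + - (4))) by (eexists; apply is_derive_st).
assert (D2 : ex_derive st1 (2 * z + - (4))) by (eexists; apply is_derive_st1).
split; [|split].
- unfold ratH, Rminus; auto_derive; [auto|].
  change (fun u : R => st u) with st; rewrite (is_derive_unique _ _ _ (is_derive_st _)).
  replace (X * / 2) with (X / 2) by reflexivity; field.
- apply (ex_derive_continuous (V := R_NormedModule)); unfold Rminus; auto_derive; auto.
- unfold ratH; destruct (Rle_dec (5 / 2) z) as [H|H].
  { rewrite (st_ge1 (2 * z - 4)), (st1_out (2 * z - 4)) by lra.
    split; rewrite ?Rmult_1_r; match goal with |- Rabs ?a <= _ => replace a with 0 by ring end;
    rewrite Rabs_R0; lra. }
  assert (E : exp (- (X / 2) * ((z - 3) * (z - 11))) <= exp (- X)).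
  { apply exp_le_expX; assert (2 <= (z - 3) * (z - 11)) by nra; nra. }
  assert (P' := exp_pos (- (X / 2) * ((z - 3) * (z - 11)))).
  destruct (st_range (2 * z - 4)) as [S0 S1]; destruct (HS (2 * z - 4)) as [_ [S2 _]].
  split; rewrite Rabs_mult, (Rabs_pos_eq (exp _)) by lra.
  + rewrite (Rabs_pos_eq (1 + _)) by lra; nra.
  + assert (T : Rabs (X * (7 - z) * (1 + -1 * st (2 * z - 4)) - 2 * st1 (2 * z - 4)) <= 8 * X + 2 * K).
    { assert (0 <= X * (7 - z) <= 8 * X) by nra.
      apply Rabs_le_between in S2; apply Rabs_le; nra. }
    apply Rle_trans with (exp (- X) * (8 * X + 2 * K)); [|nra].
    apply Rmult_le_compat; try lra; apply Rabs_pos.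
Qed.

(** The cutoff removes z <= 7/2, and the window ends at 17/2, well before the second root 11, so (z
    - 3) (z - 11) <= -2 on what remains. *)
Lemma c1_ratL : C1b Wz (exp (- X)) (8 + 2 * K) (fun _ _ t => ratL X t).
Proof.
destruct X_ge as [HX [_ HX']]; destruct (mul_exp_neg_le X ltac:(lra)) as [B1 _].
destruct expN_le as [_ [P [_ [_ B2]]]].
apply (C1b_t _ _ _ (ratL X) (fun z => exp (X / 2 * ((z - 3) * (z - 11)))
  * (X * (z - 7) * st (2 * z - 7) + 2 * st1 (2 * z - 7)))); [|lra].
intros z [Hz1 Hz2].
assert (D1 : ex_derive st (2 * z + - (7))) by (eexists; apply is_derive_st).
assert (D2 : ex_derive st1 (2 * z + - (7))) by (eexists; apply is_derive_st1).
split; [|split].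
- unfold ratL, Rminus; auto_derive; [auto|].
  change (fun u : R => st u) with st; rewrite (is_derive_unique _ _ _ (is_derive_st _)).
  replace (X * / 2) with (X / 2) by reflexivity; field.
- apply (ex_derive_continuous (V := R_NormedModule)); unfold Rminus; auto_derive; auto.
- unfold ratL; destruct (Rle_dec z (7 / 2)) as [H|H].
  { rewrite (st_le0 (2 * z - 7)), (st1_out (2 * z - 7)) by lra.
    split; rewrite ?Rmult_0_r; match goal with |- Rabs ?a <= _ => replace a with 0 by ring end;
    rewrite Rabs_R0; lra. }
  assert (E : exp (X / 2 * ((z - 3) * (z - 11))) <= exp (- X)).
  { apply exp_le_expX; assert ((z - 3) * (z - 11) <= -2) by nra; nra. }
  assert (P' := exp_pos (X / 2 * ((z - 3) * (z - 11)))).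
  destruct (st_range (2 * z - 7)) as [S0 S1]; destruct (HS (2 * z - 7)) as [_ [S2 _]].
  split; rewrite Rabs_mult, (Rabs_pos_eq (exp _)) by lra.
  + rewrite (Rabs_pos_eq (st _)) by lra; nra.
  + assert (T : Rabs (X * (z - 7) * st (2 * z - 7) + 2 * st1 (2 * z - 7)) <= 8 * X + 2 * K).
    { assert (- 8 * X <= X * (z - 7) <= 8 * X) by nra.
      apply Rabs_le_between in S2; apply Rabs_le; nra. }
    apply Rle_trans with (exp (- X) * (8 * X + 2 * K)); [|nra].
    apply Rmult_le_compat; try lra; apply Rabs_pos.
Qed.

Context (M : R) (HM : 3000 * K ^ 2 * (1 + mu) <= M).

(** Common to both corrections: [G] and [H] are the prefactors of the ratio [gr] in the amplitude
    and in the denominator, and the constants cover the larger of the two cases. The factor 1/X in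
    front of [G] is what compensates the frequency k. *)
Lemma window_corr_bounds G H v gr :
  C1b Wz (21 * K) (23 * K) G -> C1b Wz (40 * K) (100 * K) H ->
  C1b Wz (exp (- X)) (8 + 2 * K) (fun _ _ t => gr t) ->
  C1b Wz 1 1 (fun _ _ t => v t) ->
  exists e0 w1, 0 <= e0 /\ 0 <= w1 /\ e0 <= / N ^ 2 / 16 /\ e0 * (w1 + 3 * k) <= M /\
    C1b Wz e0 M (fun x y t => / X * (G x y t * gr t)) /\
    C1b Wz (1 / 2) w1 (fun x y t => H x y t * gr t) /\
    C1b Wz 1 1 (fun _ _ t => v t).
Proof.
intros HG HH Hr Hv.
destruct X_ge as [X1 [X2 X3]]; destruct expN_le as [_ [P [B1 [B2 B3]]]].
assert (HM' : 3000 * K ^ 2 <= M) by (assert (0 <= 3000 * K ^ 2 * mu) by (apply Rmult_le_pos; nra); nra).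
assert (X4 : 0 < / X <= 1).
{ split; [apply Rinv_0_lt_compat; lra|].
  rewrite <- Rinv_1; apply Rinv_le_contravar; lra. }
assert (X5 : / X * k <= 1).
{ apply Rmult_le_reg_l with X; [lra|]. rewrite <- Rmult_assoc, Rinv_r by lra; lra. }
assert (Q : 0 <= 21 * K * exp (- X)) by nra.
(* The sup bound of the product with [G], and the product rule bound for the derivative of [H] times
   [gr]. *)
exists (/ X * (21 * K * exp (- X))), (100 * K * exp (- X) + 40 * K * (8 + 2 * K)).
split; [nra|split; [nra|]].
assert (W1 : 100 * K * exp (- X) + 40 * K * (8 + 2 * K) <= 500 * K ^ 2).
{ assert (100 * K * exp (- X) <= 100 * K) by nra; nra. }
split; [|split; [|split; [|split; [|exact Hv]]]].
- assert (/ X * (21 * K * exp (- X)) <= 21 * K * exp (- X)) by nra.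
  replace (/ N ^ 2 / 16) with (/ (16 * N ^ 2)) by (field; lra); lra.
- apply Rle_trans with ((21 * K * exp (- X)) * (500 * K ^ 2) + (/ X * k) * 3 * (21 * K * exp (- X)));
    [|assert ((21 * K * exp (- X)) * (500 * K ^ 2) <= 1 / 2 * (500 * K ^ 2)) by nra;
      assert ((/ X * k) * 3 * (21 * K * exp (- X)) <= 1 * 3 * (1 / 2)) by nra; nra].
  set (w1 := 100 * K * exp (- X) + 40 * K * (8 + 2 * K)) in *.
  assert (0 <= w1) by (unfold w1; nra).
  replace (/ X * (21 * K * exp (- X)) * (w1 + 3 * k))
    with (/ X * ((21 * K * exp (- X)) * w1) + (/ X * k) * 3 * (21 * K * exp (- X))) by ring.
  apply Rplus_le_compat_r.
  apply Rle_trans with (21 * K * exp (- X) * w1); [|nra].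
  assert (0 <= 21 * K * exp (- X) * w1) by nra; nra.
- generalize (C1b_mult _ _ _ _ _ _ _ (C1b_const Wz (/ X)) (C1b_mult _ _ _ _ _ _ _ HG Hr)).
  rewrite (Rabs_pos_eq (/ X)) by lra; apply C1b_weaken; [lra|].
  assert (23 * K * exp (- X) + 21 * K * (8 + 2 * K) <= 270 * K ^ 2)
    by (assert (23 * K * exp (- X) <= 23 * K) by nra; nra).
  assert (0 <= 23 * K * exp (- X) + 21 * K * (8 + 2 * K)) by nra.
  nra.
- generalize (C1b_mult _ _ _ _ _ _ _ HH Hr); apply C1b_weaken; lra.
Qed.

Lemma c1_invX U : C1b U 1 0 (fun _ _ _ => / X).
Proof.
destruct X_ge as [X1 [X2 X3]].
generalize (C1b_const U (/ X)); apply C1b_weaken; [|lra].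
rewrite Rabs_pos_eq by (apply Rlt_le, Rinv_0_lt_compat; lra).
rewrite <- Rinv_1; apply Rinv_le_contravar; lra.
Qed.

Lemma c1_inv1 : C1b Wz 2 4 (fun _ _ t => / (t + 1)).
Proof.
generalize (C1b_inv Wz _ _ (1 / 2) (fun _ _ t => t + 1) ltac:(lra) ltac:(intros ? ? t [? ?]; lra)
  (c1_lin 1 ltac:(lra))).
apply C1b_weaken; lra.
Qed.

Lemma c1_inv9 : C1b Wz (1 / 8) 1 (fun _ _ t => / (t + 9)).
Proof.
generalize (C1b_inv Wz _ _ 8 (fun _ _ t => t + 9) ltac:(lra) ltac:(intros ? ? t [? ?]; lra)
  (c1_lin 9 ltac:(lra))).
apply C1b_weaken; lra.
Qed.

Lemma Rabs_neg1 : Rabs (-1) = 1.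
Proof. rewrite Rabs_left; lra. Qed.

Lemma Rabs_neg2 : Rabs (-2) = 2.
Proof. rewrite Rabs_left; lra. Qed.

Lemma c1_inv_N h : C1b Wz 2 4 (fun _ _ t => h t) -> C1b Wz 1 1 (fun _ _ t => / N * h t).
Proof.
intros T; generalize (C1b_mult _ _ _ _ _ _ _ (C1b_const Wz (/ N)) T).
assert (0 < / N <= / 10) by (split; [apply Rinv_0_lt_compat; lra|apply Rinv_le_contravar; lra]).
rewrite (Rabs_pos_eq (/ N)) by lra; apply C1b_weaken; lra.
Qed.

Lemma window_corrx : let d := window N mu k in
  corr Wz M (/ N ^ 2) (kx d) (ky d) (qx d) (wx d) (vx d).
Proof.
assert (IX := c1_invX Wz).
destruct (window_corr_bounds
  (fun _ _ z => - (1 / 2) * (/ X * st2 (z - 4)) + (z + 9) * st1 (z - 4))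
  (fun _ _ z => (/ X * st1 (z - 4) + (z + 9) * (1 + -1 * st (z - 4))) * (1 / 2 * / (z + 1)))
  (fun z => / N * / (z + 1)) (ratL X)) as [e0 [w1 [P0 [P1 [P2 [P3 P4]]]]]].
- generalize (C1b_plus _ _ _ _ _ _ _
    (C1b_mult _ _ _ _ _ _ _ (C1b_const Wz (- (1 / 2))) (C1b_mult _ _ _ _ _ _ _ IX (c1_st2 4)))
    (C1b_mult _ _ _ _ _ _ _ (c1_lin 9 ltac:(lra)) (c1_st1 4))).
  rewrite Rabs_Ropp, (Rabs_pos_eq (1 / 2)) by lra; apply C1b_weaken; lra.
- generalize (C1b_mult _ _ _ _ _ _ _ (C1b_plus _ _ _ _ _ _ _
      (C1b_mult _ _ _ _ _ _ _ IX (c1_st1 4))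
      (C1b_mult _ _ _ _ _ _ _ (c1_lin 9 ltac:(lra)) (C1b_plus _ _ _ _ _ _ _ (C1b_const Wz 1)
         (C1b_mult _ _ _ _ _ _ _ (C1b_const Wz (-1)) (c1_st0 4)))))
    (C1b_mult _ _ _ _ _ _ _ (C1b_const Wz (1 / 2)) c1_inv1)).
  rewrite Rabs_neg1, (Rabs_pos_eq (1/2)), (Rabs_pos_eq 1) by lra; apply C1b_weaken; lra.
- apply c1_ratL.
- apply (c1_inv_N _ c1_inv1).
- exists e0, w1; do 3 (split; [assumption|]); split; [|exact P4].
  simpl; rewrite Rplus_assoc; replace (k + 2 * k) with (3 * k) by ring; exact P3.
Qed.

Lemma window_corry : let d := window N mu k in
  corr Wz M (/ N ^ 2) (ky d) (kx d) (qy d) (wy d) (vy d).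
Proof.
assert (IX := c1_invX Wz).
destruct (window_corr_bounds
  (fun _ _ z => 1 / 2 * (/ X * st2 (z - 1)) + -2 * ((z + 1) * st1 (z - 1)))
  (fun _ _ z => (-1 * (/ X * st1 (z - 1)) + 2 * ((z + 1) * st (z - 1))) * / (z + 9))
  (fun z => / N * / (z + 9)) (ratH X)) as [e0 [w1 [P0 [P1 [P2 [P3 P4]]]]]].
- generalize (C1b_plus _ _ _ _ _ _ _
    (C1b_mult _ _ _ _ _ _ _ (C1b_const Wz (1 / 2)) (C1b_mult _ _ _ _ _ _ _ IX (c1_st2 1)))
    (C1b_mult _ _ _ _ _ _ _ (C1b_const Wz (-2))
      (C1b_mult _ _ _ _ _ _ _ (c1_lin 1 ltac:(lra)) (c1_st1 1)))).
  rewrite Rabs_neg2, (Rabs_pos_eq (1/2)) by lra; apply C1b_weaken; lra.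
- generalize (C1b_mult _ _ _ _ _ _ _ (C1b_plus _ _ _ _ _ _ _
      (C1b_mult _ _ _ _ _ _ _ (C1b_const Wz (-1)) (C1b_mult _ _ _ _ _ _ _ IX (c1_st1 1)))
      (C1b_mult _ _ _ _ _ _ _ (C1b_const Wz 2)
         (C1b_mult _ _ _ _ _ _ _ (c1_lin 1 ltac:(lra)) (c1_st0 1))))
    c1_inv9).
  rewrite Rabs_neg1, (Rabs_pos_eq 2) by lra; apply C1b_weaken; lra.
- apply c1_ratH.
- apply (c1_inv_N (fun t => / (t + 9))); generalize c1_inv9; apply C1b_weaken; lra.
- exists e0, w1; do 3 (split; [assumption|]); split; [|exact P4].
  simpl; rewrite Rplus_assoc; replace (2 * k + k) with (3 * k) by ring; exact P3.
Qed.

Lemma window_diagx : diagc Wz M (/ N ^ 2) (cx (window N mu k)).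
Proof.
destruct X_ge as [X1 [X2 X3]].
assert (HX : 0 < / X <= 1/10).
{ split; [apply Rinv_0_lt_compat; lra|].
  replace (1/10) with (/ 10) by lra; apply Rinv_le_contravar; lra. }
assert (HNX : 0 <= (N / X) ^ 2 <= 1).
{ assert (0 <= N / X <= 1) by (split; [apply Rdiv_le_0_compat; lra|apply Rle_div_l; lra]). nra. }
assert (HN2 : / N ^ 2 <= 1 / 8).
{ replace (1/8) with (/ 8) by lra; apply Rinv_le_contravar; nra. }
split.
- generalize (C1b_plus _ _ _ _ _ _ _ (C1b_const Wz 1) (C1b_mult _ _ _ _ _ _ _
    (C1b_plus _ _ _ _ _ _ _ (C1b_const Wz 1)
      (C1b_mult _ _ _ _ _ _ _ (C1b_const Wz (-1)) (c1_st 2 10)))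
    (C1b_plus _ _ _ _ _ _ _ (C1b_mult _ _ _ _ _ _ _ (c1_lin 9 ltac:(lra)) (c1_lin 9 ltac:(lra)))
      (C1b_const Wz (- / X + mu * (N / X) ^ 2 - 1))))).
  assert (HC : Rabs (- / X + mu * (N / X) ^ 2 - 1) <= 2 + mu) by (apply Rabs_le; nra).
  rewrite Rabs_neg1, (Rabs_pos_eq 2), (Rabs_pos_eq 1) by lra.
  set (C := Rabs _) in *.
  assert (K * C <= K * (2 + mu)) by (apply Rmult_le_compat_l; lra).
  assert (1 + mu <= K * (1 + mu)) by nra.
  assert (K * (1 + mu) <= K ^ 2 * (1 + mu)) by (apply Rmult_le_compat_r; nra).
  assert (K <= K * (1 + mu)) by nra.
  apply C1b_weaken; lra.
- intros z [H1 H2]; destruct (st_range (2 * z - 10)) as [S0 S1].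
  assert (0 <= mu * (N / X) ^ 2) by nra.
  assert (64 <= (z + 9) * (z + 9)) by nra.
  change (/ N ^ 2 <= 1 + (1 + -1 * st (2 * z - 10))
    * ((z + 9) * (z + 9) + (- / X + mu * (N / X) ^ 2 - 1))).
  set (A := _ + (_ + _ - 1)); assert (0 <= A) by (unfold A; lra).
  nra.
Qed.

(** The coefficient is a convex combination of 1 and of the exact one, which is at least 1/4 - 1/20
    = 1/5 since z + 1 > 1/2 on the window. *)
Lemma window_diagy : diagc Wz M (/ N ^ 2) (cy (window N mu k)).
Proof.
destruct X_ge as [X1 [X2 X3]].
assert (HX : 0 < / (2 * X) <= 1/20).
{ split; [apply Rinv_0_lt_compat; lra|].
  replace (1/20) with (/ 20) by lra; apply Rinv_le_contravar; lra. }
assert (HNX : 0 <= (N / (2 * X)) ^ 2 <= 1).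
{ assert (0 <= N / (2 * X) <= 1) by (split; [apply Rdiv_le_0_compat; lra|apply Rle_div_l; lra]). nra. }
assert (HN2 : / N ^ 2 <= 1 / 8).
{ replace (1/8) with (/ 8) by lra; apply Rinv_le_contravar; nra. }
split.
- generalize (C1b_plus _ _ _ _ _ _ _ (C1b_const Wz 1) (C1b_mult _ _ _ _ _ _ _ (c1_st 2 1)
    (C1b_plus _ _ _ _ _ _ _ (C1b_mult _ _ _ _ _ _ _ (c1_lin 1 ltac:(lra)) (c1_lin 1 ltac:(lra)))
      (C1b_const Wz (- / (2 * X) + mu * (N / (2 * X)) ^ 2 - 1))))).
  assert (HC : Rabs (- / (2 * X) + mu * (N / (2 * X)) ^ 2 - 1) <= 2 + mu) by (apply Rabs_le; nra).
  rewrite (Rabs_pos_eq 2), (Rabs_pos_eq 1) by lra.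
  set (C := Rabs _) in *.
  assert (K * C <= K * (2 + mu)) by (apply Rmult_le_compat_l; lra).
  assert (1 + mu <= K * (1 + mu)) by nra.
  assert (K * (1 + mu) <= K ^ 2 * (1 + mu)) by (apply Rmult_le_compat_r; nra).
  assert (K <= K * (1 + mu)) by nra.
  apply C1b_weaken; lra.
- intros z [H1 H2]; destruct (st_range (2 * z - 1)) as [S0 S1].
  assert (0 <= mu * (N / (2 * X)) ^ 2) by nra.
  assert (1/4 <= (z + 1) * (z + 1)) by nra.
  change (/ N ^ 2 <= 1 + st (2 * z - 1)
    * ((z + 1) * (z + 1) + (- / (2 * X) + mu * (N / (2 * X)) ^ 2 - 1))).
  set (A := _ + (_ + _ - 1)); assert (- (4 / 5) <= A) by (unfold A; lra).
  nra.
Qed.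

(** A frequency factor and a t derivative each cost at most a multiple of X, so each of the three
    quantities is at most a constant times X^2 exp (- X), hence at most 4 times that constant. *)
Lemma amp_of_decay p q r (E : R -> R) Q a b c :
  1 <= Q <= X ->
  (forall z, Wz z -> 0 < E z <= exp (- X)) ->
  (forall z, Wz z -> is_derive (fun z => p z * E z) z (q z * E z) /\
    is_derive (fun z => q z * E z) z (r z * E z) /\ continuous (fun z => r z * E z) z /\
    Rabs (p z) <= a /\ Rabs (q z) <= b * X /\ Rabs (r z) <= c * X ^ 2) ->
  4 * a <= M -> 4 * b <= M -> 4 * c <= M ->
  amp Wz M Q (fun z => p z * E z) (fun z => q z * E z) (fun z => r z * E z).
Proof.
intros HQ HE H Ha Hb Hc z Hz.
destruct (H z Hz) as [A [B [C [D [F G]]]]]; destruct (HE z Hz) as [P0 P1].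
do 3 (split; [assumption|]).
destruct X_ge as [X1 [X2 X3]]; destruct (mul_exp_neg_le X ltac:(lra)) as [_ B2].
assert (B3 : X ^ 2 * E z <= 4) by (apply Rle_trans with (X ^ 2 * exp (- X)); [|exact B2];
  apply Rmult_le_compat_l; [nra|lra]).
rewrite !Rabs_mult, !(Rabs_pos_eq (E z)) by lra.
assert (Pp := Rabs_pos (p z)); assert (Pq := Rabs_pos (q z)); assert (Pr := Rabs_pos (r z)).
assert (0 <= a) by lra. assert (0 <= b) by nra.
assert (HX2 : 0 < X ^ 2) by nra.
assert (0 <= c) by (apply Rmult_le_reg_r with (X ^ 2); lra).
split; [|split].
- apply Rle_trans with (a * (X ^ 2 * E z)); [|nra].
  replace (Q ^ 2 * (Rabs (p z) * E z)) with (Rabs (p z) * (Q ^ 2 * E z)) by ring.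
  apply Rmult_le_compat; try assumption; [|apply Rmult_le_compat_r; [lra|nra]].
  apply Rmult_le_pos; nra.
- apply Rle_trans with (b * (X ^ 2 * E z)); [|nra].
  replace (Q * (Rabs (q z) * E z)) with ((Rabs (q z) * Q) * E z) by ring.
  replace (b * (X ^ 2 * E z)) with (((b * X) * X) * E z) by ring.
  apply Rmult_le_compat_r; [lra|]; apply Rmult_le_compat; lra.
- apply Rle_trans with (c * (X ^ 2 * E z)); [|nra].
  rewrite <- Rmult_assoc; apply Rmult_le_compat_r; lra.
Qed.

Lemma expL_bounds z : Wz z -> 0 < expL N X z <= exp (- X).
Proof.
destruct X_ge as [X1 [X2 X3]]; intros [Z1 Z2]; split; [apply exp_pos|apply exp_le_expX].
assert (2 <= (z + 9) ^ 2) by nra.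
assert (X * 2 <= X * (z + 9) ^ 2) by (apply Rmult_le_compat_l; lra).
lra.
Qed.

Lemma expH_bounds z : 0 < expH N X z <= exp (- X).
Proof.
destruct X_ge as [X1 [X2 X3]]; split; [apply exp_pos|apply exp_le_expX].
assert (0 <= (z + 1) ^ 2) by apply pow2_ge_0.
assert (0 <= X * (z + 1) ^ 2) by (apply Rmult_le_pos; lra).
lra.
Qed.

Lemma is_derive_expL z : is_derive (expL N X) z (- X * (z + 9) * expL N X z).
Proof. unfold expL; auto_derive; auto; unfold Rminus, Rdiv; simpl pow; field. Qed.

Lemma is_derive_expH z : is_derive (expH N X) z (- 2 * X * (z + 1) * expH N X z).
Proof. unfold expH; auto_derive; auto; unfold Rminus, Rdiv; simpl pow; field. Qed.

Lemma window_ampx : let d := window N mu k in amp Wz M (kx d) (fx d) (fx1 d) (fx2 d).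
Proof.
destruct X_ge as [X1 [X2 X3]].
assert (HX2 : 10 * X <= X ^ 2) by nra.
assert (1 <= K ^ 2) by nra. assert (K <= K ^ 2) by nra.
assert (0 <= K ^ 2 * mu) by nra.
apply (amp_of_decay (fun z => 1 - st (z - 4))
  (fun z => - st1 (z - 4) - X * (z + 9) * (1 - st (z - 4)))
  (fun z => - st2 (z - 4) + 2 * X * (z + 9) * st1 (z - 4)
               + (X ^ 2 * (z + 9) ^ 2 - X) * (1 - st (z - 4)))
  (expL N X) k 1 (19 * K) (362 * K)); try lra.
- apply expL_bounds.
- intros z [Z1 Z2].
  assert (D0 : ex_derive st (z + - (4))) by (eexists; apply is_derive_st).
  assert (D1 : ex_derive st1 (z + - (4))) by (eexists; apply is_derive_st1).
  assert (D2 : ex_derive st2 (z + - (4))) by (eexists; apply is_derive_st2).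
  assert (D3 : ex_derive (expL N X) z) by (eexists; apply is_derive_expL).
  destruct (st_range (z - 4)) as [S0 S1]; destruct (HS (z - 4)) as [_ [B1 [B2 _]]].
  apply Rabs_le_between in B1, B2.
  split; [|split; [|split; [|split; [|split]]]].
  + unfold Rminus; auto_derive; [auto|].
    change (fun u : R => expL N X u) with (expL N X);
    rewrite (is_derive_unique _ _ _ (is_derive_expL z)).
    change (fun u : R => st u) with st; rewrite (is_derive_unique _ _ _ (is_derive_st _)).
    field.
  + unfold Rminus; auto_derive; [auto|].
    change (fun u : R => expL N X u) with (expL N X);
    rewrite (is_derive_unique _ _ _ (is_derive_expL z)).
    change (fun u : R => st u) with st; rewrite (is_derive_unique _ _ _ (is_derive_st _)).
    change (fun u : R => st1 u) with st1; rewrite (is_derive_unique _ _ _ (is_derive_st1 _)).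
    field.
  + apply (ex_derive_continuous (V := R_NormedModule)); unfold Rminus; auto_derive; auto.
  + apply Rabs_le; lra.
  + assert (0 <= (z + 9) * (1 - st (z - 4)) <= 18) by nra.
    assert (0 <= X * ((z + 9) * (1 - st (z - 4))) <= X * 18)
      by (split; [apply Rmult_le_pos; lra|apply Rmult_le_compat_l; lra]).
    assert (K <= K * X) by nra. assert (X <= K * X) by nra.
    apply Rabs_le; lra.
  + assert (0 <= (z + 9) ^ 2 <= 324) by nra.
    assert (T1 : 0 <= (z + 9) ^ 2 * (1 - st (z - 4)) <= 324) by nra.
    assert (T2 : 0 <= X ^ 2 * ((z + 9) ^ 2 * (1 - st (z - 4))) <= X ^ 2 * 324)
      by (split; [apply Rmult_le_pos; lra|apply Rmult_le_compat_l; lra]).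
    assert (T3 : 0 <= X * (1 - st (z - 4)) <= X) by nra.
    assert (T4 : - (18 * K) <= (z + 9) * st1 (z - 4) <= 18 * K) by nra.
    assert (T5 : X * (- (18 * K)) <= X * ((z + 9) * st1 (z - 4)) <= X * (18 * K))
      by (split; apply Rmult_le_compat_l; lra).
    assert (K * (10 * X) <= K * X ^ 2) by (apply Rmult_le_compat_l; lra).
    assert (X ^ 2 <= K * X ^ 2) by nra. assert (K <= K * X) by nra.
    apply Rabs_le; split; lra.
Qed.

Lemma window_ampy : let d := window N mu k in amp Wz M (ky d) (fy d) (fy1 d) (fy2 d).
Proof.
destruct X_ge as [X1 [X2 X3]].
assert (HX2 : 10 * X <= X ^ 2) by nra.
assert (1 <= K ^ 2) by nra. assert (K <= K ^ 2) by nra.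
assert (0 <= K ^ 2 * mu) by nra.
apply (amp_of_decay (fun z => st (z - 1))
  (fun z => st1 (z - 1) - 2 * X * (z + 1) * st (z - 1))
  (fun z => st2 (z - 1) - 4 * X * (z + 1) * st1 (z - 1)
               + (4 * X ^ 2 * (z + 1) ^ 2 - 2 * X) * st (z - 1))
  (expH N X) (2 * k) 1 (21 * K) (443 * K)); try lra.
- split; [lra|unfold X; nra].
- intros z _; apply expH_bounds.
- intros z [Z1 Z2].
  assert (D0 : ex_derive st (z + - (1))) by (eexists; apply is_derive_st).
  assert (D1 : ex_derive st1 (z + - (1))) by (eexists; apply is_derive_st1).
  assert (D2 : ex_derive st2 (z + - (1))) by (eexists; apply is_derive_st2).
  assert (D3 : ex_derive (expH N X) z) by (eexists; apply is_derive_expH).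
  destruct (st_range (z - 1)) as [S0 S1]; destruct (HS (z - 1)) as [_ [B1 [B2 _]]].
  apply Rabs_le_between in B1, B2.
  split; [|split; [|split; [|split; [|split]]]].
  + unfold Rminus; auto_derive; [auto|].
    change (fun u : R => expH N X u) with (expH N X);
    rewrite (is_derive_unique _ _ _ (is_derive_expH z)).
    change (fun u : R => st u) with st; rewrite (is_derive_unique _ _ _ (is_derive_st _)).
    ring.
  + unfold Rminus; auto_derive; [auto|].
    change (fun u : R => expH N X u) with (expH N X);
    rewrite (is_derive_unique _ _ _ (is_derive_expH z)).
    change (fun u : R => st u) with st; rewrite (is_derive_unique _ _ _ (is_derive_st _)).
    change (fun u : R => st1 u) with st1; rewrite (is_derive_unique _ _ _ (is_derive_st1 _)).
    ring.
  + apply (ex_derive_continuous (V := R_NormedModule)); unfold Rminus; auto_derive; auto.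
  + apply Rabs_le; lra.
  + assert (0 <= (z + 1) * st (z - 1) <= 10) by nra.
    assert (0 <= X * ((z + 1) * st (z - 1)) <= X * 10)
      by (split; [apply Rmult_le_pos; lra|apply Rmult_le_compat_l; lra]).
    assert (K <= K * X) by nra. assert (X <= K * X) by nra.
    apply Rabs_le; lra.
  + assert (0 <= (z + 1) ^ 2 <= 100) by nra.
    assert (T1 : 0 <= (z + 1) ^ 2 * st (z - 1) <= 100) by nra.
    assert (T2 : 0 <= X ^ 2 * ((z + 1) ^ 2 * st (z - 1)) <= X ^ 2 * 100)
      by (split; [apply Rmult_le_pos; lra|apply Rmult_le_compat_l; lra]).
    assert (T3 : 0 <= X * st (z - 1) <= X) by nra.
    assert (T4 : - (10 * K) <= (z + 1) * st1 (z - 1) <= 10 * K) by nra.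
    assert (T5 : X * (- (10 * K)) <= X * ((z + 1) * st1 (z - 1)) <= X * (10 * K))
      by (split; apply Rmult_le_compat_l; lra).
    assert (K * (10 * X) <= K * X ^ 2) by (apply Rmult_le_compat_l; lra).
    assert (X ^ 2 <= K * X ^ 2) by nra. assert (K <= K * X) by nra.
    apply Rabs_le; split; lra.
Qed.

(** The difference of the exponents vanishes at 3 by the choice of the constants 56, and its
    derivative, a multiple of z - 7, vanishes where the decay rates cross; the other root is
    therefore 11. *)
Lemma expH_expL z : expH N X z = expL N X z * exp (- (X / 2) * ((z - 3) * (z - 11))).
Proof. unfold expH, expL; rewrite <- exp_plus; f_equal; field. Qed.

Lemma expL_expH z : expL N X z = expH N X z * exp (X / 2 * ((z - 3) * (z - 11))).
Proof. unfold expH, expL; rewrite <- exp_plus; f_equal; field. Qed.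

(** For z <= 4 the low mode is an uncut Gaussian and [cx] is exactly the coefficient that makes it a
    solution; for z >= 5 it is absent. In between, only the terms carrying [st1] or [st2] survive,
    and dividing them by k l g gives [qx]. There the high mode g is uncut, and [vx], [wx] are - l g
    / g1 and f1 / g1 written out. *)
Lemma window_balx : let d := window N mu k in
  balance Wz (/ N ^ 2) mu (kx d) (fx d) (fx1 d) (fx2 d) (cx d) (qx d) (wx d) (vx d)
    (ky d) (fy d) (fy1 d).
Proof.
intros d z [Z1 Z2]; simpl; fold X.
destruct X_ge as [X1 [X2 X3]].
assert (N <> 0) by lra. assert (k <> 0) by lra. assert (z + 1 <> 0) by lra.
destruct (Rle_dec z 4) as [Hz|Hz]; [|destruct (Rle_dec 5 z) as [Hz'|Hz']].
- rewrite (st1_out (z - 4)), (st2_out (z - 4)), (st_le0 (z - 4)), (st_le0 (2 * z - 10)) by lra.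
  split; [ring|split; [ring|]]; unfold X; field; lra.
- rewrite (st1_out (z - 4)), (st2_out (z - 4)), (st_ge1 (z - 4)) by lra.
  split; [ring|split; [ring|ring]].
- unfold ratL; rewrite expL_expH.
  rewrite (st1_out (z - 1)), (st_ge1 (z - 1)), (st_le0 (2 * z - 10)), (st_ge1 (2 * z - 7)) by lra.
  split; [unfold X; field; lra|split; unfold X; field; lra].
Qed.

(** The same computation with the roles exchanged: while the high mode is being switched on, the low
    one is still uncut and its gradient carries the correction. *)
Lemma window_baly : let d := window N mu k in
  balance Wz (/ N ^ 2) mu (ky d) (fy d) (fy1 d) (fy2 d) (cy d) (qy d) (wy d) (vy d)
    (kx d) (fx d) (fx1 d).
Proof.
intros d z [Z1 Z2]; simpl; fold X.
destruct X_ge as [X1 [X2 X3]].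
assert (N <> 0) by lra. assert (k <> 0) by lra. assert (z + 9 <> 0) by lra.
destruct (Rle_dec z 1) as [Hz|Hz]; [|destruct (Rle_dec 2 z) as [Hz'|Hz']].
- rewrite (st1_out (z - 1)), (st2_out (z - 1)), (st_le0 (z - 1)) by lra.
  split; [ring|split; [ring|ring]].
- rewrite (st1_out (z - 1)), (st2_out (z - 1)), (st_ge1 (z - 1)), (st_ge1 (2 * z - 1)) by lra.
  split; [ring|split; [ring|]]; unfold X; field; lra.
- unfold ratH; rewrite expH_expL.
  rewrite (st1_out (z - 4)), (st_le0 (z - 4)), (st_le0 (2 * z - 4)), (st_ge1 (2 * z - 1)) by lra.
  split; [unfold X; field; lra|split; unfold X; field; lra].
Qed.

Lemma good_window : good (/ N ^ 2) mu (/ N ^ 2) M Wz (window N mu k).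
Proof.
constructor; [exact Hk|simpl; lra|apply window_ampx|apply window_ampy|apply window_diagx
  |apply window_diagy|apply window_corrx|apply window_corry|apply window_balx|apply window_baly].
Qed.

End Window.

(** * Gluing the transitions *)

(* Here [fx''/fx = N^2 t^2 - N] is negative near [t = 0]; ellipticity there uses [mu > / N]. *)
Definition center (N mu : R) : profile :=
  mkProfile 1 (fun t => exp (- (N * t ^ 2 / 2))) (fun t => - N * t * exp (- (N * t ^ 2 / 2)))
    (fun t => (N ^ 2 * t ^ 2 - N) * exp (- (N * t ^ 2 / 2)))
    (fun t => t * t + (mu - / N)) (fun _ => 0) (fun _ => 0) (fun _ => 0)
    1 (fun _ => 0) (fun _ => 0) (fun _ => 0) (fun _ => 1) (fun _ => 0) (fun _ => 0) (fun _ => 0).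

Definition Wc (t : R) : Prop := -19/2 < t < 19/2.

Lemma C1b_zero U m0 m1 : 0 <= m0 -> 0 <= m1 -> C1b U m0 m1 (fun _ _ _ => 0).
Proof. intros H0 H1; generalize (C1b_const U 0); apply C1b_weaken; rewrite ?Rabs_R0; lra. Qed.

(** The smallest value of [cx] is mu - 1/N, and 2/mu <= N makes it at least 1/N, hence at least
    1/N^2. The second mode is zero; its frequency 1 and coefficient 1 are placeholders meeting the
    conditions of [good]. *)
Lemma good_center N mu M : 10 <= N -> 2 / mu <= N -> 0 < mu -> 200 * N ^ 2 + mu <= M ->
  good (/ N ^ 2) mu (/ N ^ 2) M Wc (center N mu).
Proof.
intros HN HNm Hmu HM.
assert (HN2 : 100 <= N ^ 2) by nra.
assert (I1 : 0 < / N <= 1 / 10).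
{ split; [apply Rinv_0_lt_compat; lra|].
  replace (1/10) with (/ 10) by lra; apply Rinv_le_contravar; lra. }
assert (I2 : / N ^ 2 = / N * / N) by (field; lra).
assert (I3 : 0 < / N ^ 2 <= / N) by (rewrite I2; split; nra).
assert (I4 : 2 * / N <= mu).
{ apply Rle_div_l in HNm; [|lra]. apply Rmult_le_reg_r with N; [lra|].
  rewrite Rmult_assoc, Rinv_l by lra; lra. }
assert (Z : corr Wc M (/ N ^ 2) 1 1 (fun _ => 0) (fun _ => 0) (fun _ => 0)).
{ exists 0, 0; repeat split; try lra; apply C1b_zero; lra. }
constructor; simpl kx; simpl ky; try lra; try exact Z.
- intros t [T1 T2]; cbn [center kx fx fx1 fx2].
  assert (E : 0 < exp (- (N * t ^ 2 / 2)) <= 1).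
  { split; [apply exp_pos|]. rewrite <- exp_0.
    assert (0 <= N * t ^ 2) by (apply Rmult_le_pos; [lra|apply pow2_ge_0]).
    assert (H' : - (N * t ^ 2 / 2) <= 0) by lra.
    destruct H' as [H'|H']; [left; apply exp_increasing, H'|rewrite H'; lra]. }
  assert (B : 0 <= t ^ 2 <= 91) by nra.
  split; [|split; [|split; [|split; [|split]]]].
  + auto_derive; auto; unfold Rminus, Rdiv; simpl pow; field.
  + auto_derive; auto; unfold Rminus, Rdiv; simpl pow; field.
  + apply (ex_derive_continuous (V := R_NormedModule)); auto_derive; auto.
  + rewrite (Rabs_pos_eq (exp _)) by lra; nra.
  + rewrite !Rabs_mult, Rabs_Ropp, (Rabs_pos_eq N), (Rabs_pos_eq (exp _)) by lra.
    assert (Rabs t <= 10) by (apply Rabs_le; lra); assert (P := Rabs_pos t).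
    assert (N * Rabs t <= N * 10) by (apply Rmult_le_compat_l; lra).
    assert (0 <= N * Rabs t) by (apply Rmult_le_pos; lra).
    assert (N * Rabs t * exp (- (N * t ^ 2 / 2)) <= N * Rabs t) by nra. nra.
  + rewrite Rabs_mult, (Rabs_pos_eq (exp _)) by lra.
    assert (0 <= N ^ 2 * t ^ 2 <= N ^ 2 * 91)
      by (split; [apply Rmult_le_pos; lra|apply Rmult_le_compat_l; lra]).
    assert (Rabs (N ^ 2 * t ^ 2 - N) <= 100 * N ^ 2) by (apply Rabs_le; nra).
    assert (P := Rabs_pos (N ^ 2 * t ^ 2 - N)). nra.
- intros t _; simpl; rewrite Rabs_R0.
  split; [apply (@is_derive_const R_AbsRing)|split; [apply (@is_derive_const R_AbsRing)|]].
  split; [apply continuous_const|repeat split; lra].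
- split.
  + apply (C1b_t _ _ _ (cx (center N mu)) (fun t => 2 * t)); [|lra].
    intros t [T1 T2]; simpl; split; [auto_derive; auto; ring|split].
    * apply (ex_derive_continuous (V := R_NormedModule)); auto_derive; auto.
    * split; apply Rabs_le; nra.
  + intros t _; simpl; assert (0 <= t * t) by nra; simpl in I3; lra.
- split.
  + generalize (C1b_const Wc 1); apply C1b_weaken; rewrite ?Rabs_R1; lra.
  + intros t _; simpl; simpl in I3; lra.
- intros t _; simpl; split; [ring|split; [ring|field; lra]].
- intros t _; simpl; repeat split; ring.
Qed.

(** Equality of the profiles themselves would be too strong: where a mode is absent or a correction
    vanishes, neighbouring profiles carry different frequencies and different [w], [v]. *)
Definition same (kappa : R) (d d' : profile) (t : R) : Prop :=
  (forall x y, sol d x y t = sol d' x y t) /\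
  (forall i j x y, coeff kappa d i j x y t = coeff kappa d' i j x y t).

Lemma same_refl kappa d t : same kappa d d t.
Proof. split; reflexivity. Qed.

Lemma same_sym kappa d d' t : same kappa d d' t -> same kappa d' d t.
Proof. intros [A B]; split; intros; symmetry; auto. Qed.

Lemma same_intro kappa d d' t :
  qx d t = 0 -> qy d t = 0 -> qx d' t = 0 -> qy d' t = 0 ->
  cx d t = cx d' t -> cy d t = cy d' t ->
  (forall x, cos (kx d * x) * fx d t = cos (kx d' * x) * fx d' t) ->
  (forall y, cos (ky d * y) * fy d t = cos (ky d' * y) * fy d' t) -> same kappa d d' t.
Proof.
intros E1 E2 E3 E4 C1 C2 F G; split.
- intros x y; unfold sol; rewrite F, G; reflexivity.
- intros i j x y.
  destruct i as [|[|[|i]]], j as [|[|[|j]]]; simpl; unfold entry; rewrite ?E1, ?E2, ?E3, ?E4; auto; ring.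
Qed.

(** A shift by 8 takes the high centre -1 to the low centre -9, and 56 (2 X - N) is the low
    normalisation with X doubled, so the surviving mode continues unchanged. The other mode is zero
    on both sides, with coefficient already relaxed to 1. *)
Lemma window_overlap N mu k z : N <> 0 -> k <> 0 -> -1/2 < z < 1/2 ->
  let d := window N mu k in let d' := window N mu (2 * k) in let w := z + 8 in
  qx d w = 0 /\ qy d w = 0 /\ qx d' z = 0 /\ qy d' z = 0 /\
  cx d w = cy d' z /\ cy d w = cx d' z /\ fx d w = 0 /\ fy d' z = 0 /\
  ky d = kx d' /\ fy d w = fx d' z.
Proof.
intros HN Hk [Z1 Z2] d d' w; unfold d, d', w; simpl.
rewrite (st1_out (z + 8 - 4)), (st2_out (z + 8 - 4)), (st_ge1 (z + 8 - 4)),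
  (st1_out (z + 8 - 1)), (st2_out (z + 8 - 1)), (st_ge1 (z + 8 - 1)),
  (st1_out (z - 4)), (st2_out (z - 4)), (st_le0 (z - 4)),
  (st1_out (z - 1)), (st2_out (z - 1)), (st_le0 (z - 1)), (st_ge1 (2 * (z + 8) - 10)),
  (st_ge1 (2 * (z + 8) - 1)), (st_le0 (2 * z - 10)), (st_le0 (2 * z - 1)) by lra.
repeat split; try ring.
- field; auto.
- unfold expH, expL; rewrite Rmult_1_l, Rminus_0_r, Rmult_1_l; f_equal; field.
Qed.

Definition stage (N mu : R) (j : nat) : profile :=
  if Nat.even j then window N mu (2 ^ j) else swap (window N mu (2 ^ j)).

Definition piece (N mu : R) (m : nat) (r : R) : profile :=
  match m with
  | 0%nat => center N mu
  | S j => pull r (9 + 8 * INR j) (stage N mu j)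
  end.

(** Windows have length 9 and are spaced by 8, and the central slab reaches 19/2, half a unit past
    9: neighbours overlap on an interval of length 1. *)
Definition dom (m : nat) (r : R) : R -> Prop :=
  match m with
  | 0%nat => Wc
  | S j => fun t => Wz (r * t - (9 + 8 * INR j))
  end.

Lemma open_dom m r : open (dom m r).
Proof.
assert (O : forall a b, open (fun t => a < t < b)).
{ intros a b; apply open_and; [apply open_gt|apply open_lt]. }
destruct m as [|j]; [apply O|].
apply (open_comp (fun t => r * t - (9 + 8 * INR j)) Wz); [|apply O].
intros t _; apply (continuous_of_derive (fun t => r * t - (9 + 8 * INR j)) _ r); auto_derive; auto; ring.
Qed.

Lemma piece_overlap kappa N mu m r t : r * r = 1 -> N <> 0 ->
  -1/2 < r * t - (9 + 8 * INR m) < 1/2 ->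
  same kappa (piece N mu m r) (piece N mu (S m) r) t.
Proof.
intros Hr HN Ht.
destruct m as [|j].
- simpl INR in Ht; rewrite Rmult_0_r, Rplus_0_r in Ht.
  set (z := r * t - 9) in *.
  (* The low mode of the first window is centred at [t = 0], and [z + 9 = r * t] enters only through
     its square, so one central piece fits both reflections. *)
  assert (Ez : (z + 9) ^ 2 = t ^ 2).
  { unfold z; transitivity ((r * r) * t ^ 2); [ring|rewrite Hr; ring]. }
  assert (Ez' : (z + 9) * (z + 9) = t * t) by (simpl in Ez; lra).
  apply same_intro; simpl; rewrite ?Rmult_0_r, ?Rplus_0_r; fold z; rewrite ?Ez';
  rewrite ?(st1_out (z - 4)), ?(st2_out (z - 4)), ?(st_le0 (z - 4)),
    ?(st1_out (z - 1)), ?(st2_out (z - 1)), ?(st_le0 (z - 1)),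
    ?(st_le0 (2 * z - 10)), ?(st_le0 (2 * z - 1)) by lra; try (intros; ring).
  + field; lra.
  + intros x; f_equal; unfold expL; rewrite Rminus_0_r, Rmult_1_l; f_equal.
    rewrite Ez; simpl; field.
- set (z := r * t - (9 + 8 * INR (S j))) in *.
  assert (Ez : r * t - (9 + 8 * INR j) = z + 8) by (unfold z; rewrite S_INR; ring).
  assert (Hk : 2 ^ j <> 0) by (apply pow_nonzero; lra).
  destruct (window_overlap N mu (2 ^ j) z HN Hk Ht) as [E1 [E2 [E3 [E4 [C1 [C2 [F1 [F2 [K F3]]]]]]]]].
  unfold piece, stage; rewrite Nat.even_succ, <- Nat.negb_even.
  change (2 ^ S j) with (2 * 2 ^ j).
  destruct (Nat.even j); simpl negb; cbv iota.
  + apply same_intro; cbn [pull swap kx ky fx fy cx cy qx qy]; fold z; rewrite ?Ez;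
      try assumption; intros x; rewrite ?F1, ?F2, ?K, ?F3; ring.
  + apply same_intro; cbn [pull swap kx ky fx fy cx cy qx qy]; fold z; rewrite ?Ez;
      try assumption; intros x; rewrite ?F1, ?F2, ?K, ?F3; ring.
Qed.

(** * Selecting a piece at each t *)

Definition idx (t : R) : nat := Z.to_nat (up ((Rabs t - 9) / 8)).
Definition sgn (t : R) : R := if Rlt_dec t 0 then -1 else 1.

Lemma sgn_spec t : sgn t * sgn t = 1 /\ sgn t * t = Rabs t.
Proof.
unfold sgn; destruct (Rlt_dec t 0); [rewrite Rabs_left by lra|rewrite Rabs_pos_eq by lra]; lra.
Qed.

(** Since [up] is at most one more than its argument, it is nonpositive here, and [Z.to_nat]
    truncates it to 0. *)
Lemma idx_0 t : Rabs t < 9 -> idx t = 0%nat.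
Proof.
intros H; unfold idx; destruct (archimed ((Rabs t - 9) / 8)) as [_ A].
assert (IZR (up ((Rabs t - 9) / 8)) < 1) by lra.
apply (lt_IZR _ 1) in H0; lia.
Qed.

Lemma idx_S t j : 9 + 8 * INR j <= Rabs t < 17 + 8 * INR j -> idx t = S j.
Proof.
intros H; unfold idx; rewrite <- (tech_up _ (Z.of_nat (S j))); [apply Nat2Z.id| |];
  rewrite <- INR_IZR_INZ, S_INR; lra.
Qed.

Lemma idx_cases t : (Rabs t < 9 /\ idx t = 0%nat) \/
  exists j, 9 + 8 * INR j <= Rabs t < 17 + 8 * INR j /\ idx t = S j.
Proof.
destruct (Rlt_dec (Rabs t) 9) as [H|H]; [left; split; [exact H|apply idx_0, H]|right].
destruct (nfloor_ex ((Rabs t - 9) / 8)) as [j Hj]; [lra|].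
exists j; assert (B : 9 + 8 * INR j <= Rabs t < 17 + 8 * INR j) by lra.
split; [exact B|apply idx_S, B].
Qed.

Lemma idx_dom t : dom (idx t) (sgn t) t.
Proof.
destruct (sgn_spec t) as [_ S].
destruct (idx_cases t) as [[H E]|[j [H E]]]; rewrite E; simpl.
- apply Rabs_def2 in H; unfold Wc; lra.
- rewrite S; unfold Wz; lra.
Qed.

(** The selection by [idx] and [sgn] jumps, but on the open domain of any piece the selected one is
    that piece or a neighbour overlapping it at [t]. This turns the pointwise definition into a
    locally smooth one. *)
Lemma piece_agree kappa N mu m r t : r = 1 \/ r = -1 -> N <> 0 -> dom m r t ->
  same kappa (piece N mu (idx t) (sgn t)) (piece N mu m r) t.
Proof.
intros Hr HN Hd; destruct (sgn_spec t) as [S1 S2].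
destruct m as [|j].
- destruct (Rlt_dec (Rabs t) 9) as [H|H]; [rewrite (idx_0 _ H); apply same_refl|].
  assert (H' : Rabs t < 19 / 2) by (apply Rabs_def1; destruct Hd; lra).
  rewrite (idx_S t 0) by (simpl; lra).
  apply same_sym; change (center N mu) with (piece N mu 0 (sgn t)).
  apply (piece_overlap kappa N mu 0 (sgn t)); auto; rewrite S2; simpl; lra.
- simpl in Hd; destruct Hd as [D1 D2].
  assert (P := pos_INR j).
  (* On the domain of a window [r * t > 17/2], which determines the sign. *)
  assert (Er : r = sgn t).
  { unfold sgn; destruct (Rlt_dec t 0); destruct Hr; subst; lra. }
  subst r; rewrite S2 in D1, D2.
  destruct (Rlt_dec (Rabs t) (9 + 8 * INR j)) as [H|H].
  + assert (E : idx t = j).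
    { destruct j as [|j]; [apply idx_0; simpl in H; lra|apply idx_S; rewrite S_INR in *; lra]. }
    rewrite E; apply piece_overlap; auto; rewrite S2; lra.
  + destruct (Rlt_dec (Rabs t) (17 + 8 * INR j)) as [H'|H'].
    * rewrite (idx_S t j) by lra; apply same_refl.
    * rewrite (idx_S t (S j)) by (rewrite S_INR; lra).
      apply same_sym, piece_overlap; auto; rewrite S2, S_INR; lra.
Qed.

Lemma piece_freq N mu m r : exists a b : nat,
  kx (piece N mu m r) = INR a /\ ky (piece N mu m r) = INR b.
Proof.
assert (E : forall j, 2 ^ j = INR (2 ^ j)) by (intros; rewrite pow_INR; reflexivity).
assert (E' : forall j, 2 * 2 ^ j = INR (2 * 2 ^ j)) by (intros; rewrite mult_INR, <- E; reflexivity).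
destruct m as [|j]; simpl.
- exists 1%nat, 1%nat; split; reflexivity.
- unfold stage; destruct (Nat.even j); simpl.
  + exists (2 ^ j)%nat, (2 * 2 ^ j)%nat; split; auto.
  + exists (2 * 2 ^ j)%nat, (2 ^ j)%nat; split; auto.
Qed.

Lemma trig_period n x :
  cos (INR n * (x + 2 * PI)) = cos (INR n * x) /\ sin (INR n * (x + 2 * PI)) = sin (INR n * x).
Proof.
replace (INR n * (x + 2 * PI)) with (INR n * x + 2 * INR n * PI) by ring.
split; [apply cos_period|apply sin_period].
Qed.

Lemma piece_periodic kappa N mu m r x y t : let d := piece N mu m r in
  (sol d (x + 2 * PI) y t = sol d x y t /\ sol d x (y + 2 * PI) t = sol d x y t) /\
  forall i j, coeff kappa d i j (x + 2 * PI) y t = coeff kappa d i j x y t /\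
    coeff kappa d i j x (y + 2 * PI) t = coeff kappa d i j x y t.
Proof.
intros d; destruct (piece_freq N mu m r) as [a [b [Ea Eb]]]; fold d in Ea, Eb.
destruct (trig_period a x) as [A1 A2], (trig_period b y) as [B1 B2].
split.
- unfold sol; rewrite Ea, Eb, A1, B1; auto.
- intros i j; destruct i as [|[|[|i]]], j as [|[|[|j]]]; simpl; auto;
    unfold entry; rewrite Ea, Eb, ?A1, ?A2, ?B1, ?B2; auto.
Qed.

(** * Choice of the constants and rate of decay *)

Lemma good_piece K N mu M m r : r * r = 1 -> 1 <= K ->
  (forall x, Rabs (st x) <= 1 /\ Rabs (st1 x) <= K /\ Rabs (st2 x) <= K /\ Rabs (st3 x) <= K) ->
  0 < mu -> 10 <= N -> 2 / mu <= N -> exp (- N) * (336 * K * N ^ 2) <= 1 ->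
  3000 * K ^ 2 * (1 + mu) <= M -> 200 * N ^ 2 + mu <= M ->
  good (/ N ^ 2) mu (/ N ^ 2) M (dom m r) (piece N mu m r).
Proof.
intros Hr HK HS Hmu HN HNm HNK HM HM'.
destruct m as [|j]; [apply good_center; assumption|].
assert (G : good (/ N ^ 2) mu (/ N ^ 2) M Wz (window N mu (2 ^ j))).
{ apply (good_window K); auto; apply pow_R1_Rle; lra. }
apply (good_pull r (9 + 8 * INR j) Hr Wz).
unfold stage; destruct (Nat.even j); [exact G|apply good_swap, G].
Qed.

(** With q = (N/3) exp (- N/3) <= 1, exp (- N) N^3 = 27 q^3 <= 27, so the last quantity is at most
    336 * 27 K / N; this is the origin of 9072. *)
Lemma exists_large_N K mu : 0 < mu -> 1 <= K ->
  exists N, 10 <= N /\ 2 / mu <= N /\ exp (- N) * (336 * K * N ^ 2) <= 1.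
Proof.
intros Hmu HK.
assert (P : 0 < 2 / mu) by (apply Rdiv_lt_0_compat; lra).
set (N := 10 + 2 / mu + 9072 * K).
exists N; split; [unfold N; nra|split; [unfold N; nra|]].
assert (HN : 9072 * K <= N) by (unfold N; lra).
clearbody N.
destruct (mul_exp_neg_le (N / 3) ltac:(nra)) as [A _].
assert (A0 : 0 <= N / 3 * exp (- (N / 3))) by (apply Rmult_le_pos; [nra|apply Rlt_le, exp_pos]).
set (q := N / 3 * exp (- (N / 3))) in *.
assert (E : exp (- N) * N ^ 3 = 27 * q ^ 3).
{ unfold q; replace (exp (- N)) with (exp (- (N / 3)) * exp (- (N / 3)) * exp (- (N / 3))); [field|].
  rewrite <- !exp_plus; f_equal; field. }
assert (q ^ 3 <= 1) by (rewrite <- (pow1 3); apply pow_incr; lra).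
apply Rmult_le_reg_r with N; [nra|].
replace (exp (- N) * (336 * K * N ^ 2) * N) with (336 * K * (exp (- N) * N ^ 3)) by ring.
rewrite E; nra.
Qed.

(** Only the crude bound exp (- N k) for each Gaussian is kept; the doubling of k is enough for the
    double exponential. *)
Lemma piece_decay N mu j r t : 10 <= N -> Wz (r * t - (9 + 8 * INR j)) -> forall x y,
  Rabs (sol (piece N mu (S j) r) x y t) <= 2 * exp (- (N * 2 ^ j)).
Proof.
intros HN Hz x y.
assert (Hk : 1 <= 2 ^ j) by (apply pow_R1_Rle; lra).
set (z := r * t - (9 + 8 * INR j)) in *.
assert (L := expL_bounds N (2 ^ j) HN Hk z Hz); assert (H := expH_bounds N (2 ^ j) HN Hk z).
set (X := N * 2 ^ j) in *.
assert (C : forall a b, Rabs b <= exp (- X) -> Rabs (cos a * b) <= exp (- X)).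
{ intros a b Hb; rewrite Rabs_mult.
  assert (B : Rabs (cos a) <= 1) by apply Rabs_le, COS_bound.
  assert (P := Rabs_pos b); assert (P' := Rabs_pos (cos a)); nra. }
assert (F : Rabs (fx (window N mu (2 ^ j)) z) <= exp (- X)).
{ destruct (st_range (z - 4)); simpl; fold X; apply Rabs_le; nra. }
assert (G : Rabs (fy (window N mu (2 ^ j)) z) <= exp (- X)).
{ destruct (st_range (z - 1)); simpl; fold X; apply Rabs_le; nra. }
unfold sol; eapply Rle_trans; [apply Rabs_triang|].
replace (2 * exp (- X)) with (exp (- X) + exp (- X)) by ring.
unfold piece, stage; destruct (Nat.even j); cbn [pull swap kx ky fx fy]; fold z;
  apply Rplus_le_compat; apply C; assumption.
Qed.

Lemma pow2_ge_exp j : exp (INR j / 2) <= 2 ^ j.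
Proof.
assert (E : exp (1 / 2) <= 2).
{ assert (P := exp_pos (1 / 2)); assert (Q := exp_le_3).
  replace 1 with (1 / 2 + 1 / 2) in Q by lra; rewrite exp_plus in Q.
  destruct (Rle_dec (exp (1 / 2)) 2); [assumption|nra]. }
induction j as [|j IH].
- simpl; replace (0 / 2) with 0 by lra; rewrite exp_0; lra.
- rewrite S_INR; replace ((INR j + 1) / 2) with (1 / 2 + INR j / 2) by field.
  rewrite exp_plus; change (2 ^ S j) with (2 * 2 ^ j).
  apply Rmult_le_compat; try (apply Rlt_le, exp_pos); assumption.
Qed.

(** The frequency doubles every 8 units and 2 >= exp (1/2), hence the rate 1/16; the offset 17/16 <=
    2 costs a factor exp 2 <= 9. The 10 is the lower bound on [N]. *)
Lemma ten_pow2_ge j T : T <= 17 + 8 * INR j -> 1 / 16 * exp (1 / 16 * T) <= 10 * 2 ^ j.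
Proof.
intros H; apply Rle_trans with (10 * exp (INR j / 2)); [|generalize (pow2_ge_exp j); lra].
apply Rle_trans with (1 / 16 * exp (2 + INR j / 2)).
- apply Rmult_le_compat_l; [lra|].
  assert (L : 1 / 16 * T <= 2 + INR j / 2) by lra.
  destruct L as [L|L]; [left; apply exp_increasing, L|rewrite L; lra].
- rewrite exp_plus; assert (E : exp 2 <= 9).
  { replace 2 with (1 + 1) by lra; rewrite exp_plus; generalize exp_le_3 (exp_pos 1); nra. }
  assert (P := exp_pos (INR j / 2)); nra.
Qed.

Theorem theorem1p2 :
  forall mu : R, 0 < mu ->
  exists (A : mfun3) (u : fun3),
    (forall i j, (i < 3)%nat -> (j < 3)%nat -> periodic_xy (A i j) /\ unif_C1 (A i j)) /\
    unif_elliptic A /\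
    periodic_xy u /\ unif_C2 u /\
    (exists x y t, u x y t <> 0) /\
    (forall x y t, div_A_grad A u x y t = - mu * u x y t) /\
    (exists c C : R, 0 < c /\ 0 < C /\
       exists T0 : R, forall T : R, T0 <= T ->
         forall x y t, T <= Rabs t -> Rabs (u x y t) <= C * exp (- c * exp (c * T))).
Proof.
intros mu Hmu.
destruct st_bounds as [K [HK HS]].
destruct (exists_large_N K mu Hmu HK) as [N [HN [HNm HNK]]].
(* The sum of the requirements of the windows and of the centre; no frequency occurs in it. *)
set (M := 3000 * K ^ 2 * (1 + mu) + (200 * N ^ 2 + mu)).
set (lam := / N ^ 2).
assert (P1 : 0 <= 3000 * K ^ 2 * (1 + mu)) by (apply Rmult_le_pos; nra).
assert (P2 : 100 <= N ^ 2) by nra.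
assert (G : forall m r, r * r = 1 -> good lam mu lam M (dom m r) (piece N mu m r)).
{ intros m r Hr; apply (good_piece K); auto; unfold M; lra. }
assert (HM : 20000 <= M) by (unfold M; lra).
assert (Hlam : 0 < lam <= 1).
{ unfold lam; split; [apply Rinv_0_lt_compat; lra|].
  rewrite <- Rinv_1; apply Rinv_le_contravar; lra. }
clearbody M lam.
assert (HN0 : N <> 0) by lra.
assert (M0 : 0 <= M) by lra; assert (M1 : lam <= M) by lra.
assert (M2 : Rabs lam <= M) by (rewrite Rabs_pos_eq; lra).
set (D := fun t => piece N mu (idx t) (sgn t)).
set (A := (fun i j x y t => coeff lam (D t) i j x y t) : mfun3).
set (u := (fun x y t => sol (D t) x y t) : fun3).
(* On a neighborhood of [t0], [A] and [u] are given by the profile of [t0]. *)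
assert (Loc : forall t0, exists (U : R -> Prop) d, open U /\ U t0 /\ good lam mu lam M U d /\
  (forall x y t, U t -> u x y t = sol d x y t) /\
  (forall i j x y t, U t -> A i j x y t = coeff lam d i j x y t)).
{ intros t0; exists (dom (idx t0) (sgn t0)), (D t0).
  destruct (sgn_spec t0) as [S _].
  assert (S' : sgn t0 = 1 \/ sgn t0 = -1) by (unfold sgn; destruct (Rlt_dec t0 0); auto).
  split; [apply open_dom|split; [apply idx_dom|split; [apply G, S|split]]].
  - intros x y t Ht; apply (piece_agree lam N mu _ _ t S' HN0 Ht).
  - intros i j x y t Ht; apply (piece_agree lam N mu _ _ t S' HN0 Ht). }
exists A, u; split; [|split; [|split; [|split; [|split; [|split]]]]].
- intros i j Hi Hj; split.
  + intros x y t; apply (piece_periodic lam N mu (idx t) (sgn t) x y t).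
  + apply (C1b_unif_C1 _ M (9 * M)); intros t0.
    destruct (Loc t0) as [U [d [HU [Ht [Gd [_ EA]]]]]]; exists U; split; [exact HU|split; [exact Ht|]].
    apply (C1b_ext U _ _ _ (coeff lam d i j) HU); [intros; apply EA; assumption|].
    generalize (good_corr_bounds lam mu lam M U d M0 M1 M2 Gd i j Hi Hj).
    apply C1b_weaken; [destruct (Nat.eqb i j); lra|lra].
(* One constant above both 2 / lam, for the lower bound lam / 2, and 2 M, for the upper bound. *)
- exists (2 / lam + 2 * M).
  assert (0 < 2 / lam) by (apply Rdiv_lt_0_compat; lra).
  split; [lra|]; intros x y t xi.
  destruct (Loc t) as [U [d [HU [Ht [Gd [_ EA]]]]]].
  destruct (quadratic_form_bounds lam M (fun i j => A i j x y t) xi) as [Q1 Q2]; try lra.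
  + intros i j Hi Hj Hij; rewrite EA by exact Ht.
    destruct (good_corr_bounds lam mu lam M U d M0 M1 M2 Gd i j Hi Hj) as [df B].
    apply Nat.eqb_neq in Hij; rewrite Hij in B; apply (B x y t Ht).
  + intros i Hi; rewrite EA by exact Ht.
    destruct (good_corr_bounds lam mu lam M U d M0 M1 M2 Gd i i Hi Hi) as [df B].
    rewrite Nat.eqb_refl in B; split.
    * destruct i as [|[|[|i]]]; [apply (g_cx _ _ _ _ _ _ Gd), Ht|apply (g_cy _ _ _ _ _ _ Gd), Ht| |lia].
      simpl; lra.
    * apply Rle_trans with (1 := Rle_abs _), (B x y t Ht).
  + assert (S : 0 <= sum3 (fun i => xi i ^ 2)).
    { unfold sum3; generalize (pow2_ge_0 (xi 0%nat)) (pow2_ge_0 (xi 1%nat)) (pow2_ge_0 (xi 2%nat)); lra. }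
    split.
    * eapply Rle_trans; [|exact Q1]; apply Rmult_le_compat_r; [exact S|].
      replace (lam / 2) with (/ (2 / lam)) by (field; lra); apply Rinv_le_contravar; lra.
    * eapply Rle_trans; [exact Q2|]; apply Rmult_le_compat_r; [exact S|lra].
- intros x y t; apply (piece_periodic lam N mu (idx t) (sgn t) x y t).
- split.
  + apply (C1b_unif_C1 _ (2 * M) (4 * M)); intros t0.
    destruct (Loc t0) as [U [d [HU [Ht [Gd [Eu _]]]]]]; exists U; split; [exact HU|split; [exact Ht|]].
    apply (C1b_ext U _ _ _ (sol d) HU Eu), (good_sol lam mu lam M U d); [lra|exact Gd].
  + intros i Hi; apply (C1b_unif_C1 _ (2 * M) (4 * M)); intros t0.
    destruct (Loc t0) as [U [d [HU [Ht [Gd [Eu _]]]]]]; exists U; split; [exact HU|split; [exact Ht|]].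
    apply (C1b_ext U _ _ _ (dsol d i) HU).
    * intros x y t Ht'; apply (pd_sol lam mu lam M U d u HU Gd Eu); assumption.
    * apply (good_sol lam mu lam M U d); [lra|exact Gd|exact Hi].
- exists 0, 0, 0; unfold u, D; rewrite idx_0 by (rewrite Rabs_R0; lra).
  unfold sol; simpl; rewrite !Rmult_0_r, !Rmult_0_l, !Rmult_0_r, cos_0.
  apply Rgt_not_eq; generalize (exp_pos (- (0 / 2))); lra.
- intros x y t; destruct (Loc t) as [U [d [HU [Ht [Gd [Eu EA]]]]]].
  apply (good_pde lam mu lam M U d A u HU Gd Eu); [intros; apply EA; assumption|exact Ht].
- exists (1 / 16), 2; split; [lra|split; [lra|]].
  (* From [|t| >= 9] on, a window piece is selected and the central case is excluded. *)
  exists 9; intros T HT x y t Ht.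
  destruct (idx_cases t) as [[H _]|[j [Hj E]]]; [lra|].
  assert (Hd := idx_dom t); unfold u, D; rewrite E in *.
  eapply Rle_trans; [apply (piece_decay N mu j (sgn t) t HN Hd)|].
  apply Rmult_le_compat_l; [lra|].
  assert (B := ten_pow2_ge j T ltac:(lra)).
  assert (P : 0 < 2 ^ j) by (apply pow_lt; lra).
  assert (L : - (N * 2 ^ j) <= - (1 / 16) * exp (1 / 16 * T)) by nra.
  destruct L as [L|L]; [left; apply exp_increasing, L|rewrite L; lra].
Qed.
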